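(* Let $1\le p<\infty$, let $(\Omega,\mu)$ be a $\sigma$-finite measure space, and let $T$ be an absolutely Cesàro bounded operator on the complex space $L^p(\Omega,\mu)$. Put $p'=\min(p,2)$ and $p''=\max(p,2)$. Then $\|T^n\|_p=O\big(n^{1/p'}/(\log n)^{1/p''}\big)$ as $n\to\infty$. Moreover, there exists $C_p>0$ such that for every $x\in L^p(\Omega,\mu)$ and every integer $N\ge1$, $$\sum_{k=0}^{N-1}\|T^kx\|_p^{p''}\le C_p\,N^{p''/p'}\,\|x\|_p^{p''} .$$
   Context: A bounded linear operator $T$ on a Banach space $X$ is absolutely Cesàro bounded if there is $C>0$ such that $\sup_{n\ge1}\frac1n\sum_{k=0}^{n-1}\|T^kx\|\le C\|x\|$ for all $x\in X$. Here $\|T^n\|_p$ is the operator norm of $T^n$ on $L^p(\Omega,\mu)$. The constant $C_p$ may depend on $T$ (but not on $x$ or $N$). *)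

(* Defs.v *)
From HB Require Import structures.
From mathcomp Require Import all_boot all_order all_algebra.
From mathcomp Require Import all_classical all_reals all_analysis.
From mathcomp Require Import measurable_realfun complex ring_quotient.

Set Implicit Arguments.
Unset Strict Implicit.
Unset Printing Implicit Defensive.
Import Order.TTheory GRing.Theory Num.Theory.
Import numFieldNormedType.Exports.
Import Normc.
Local Open Scope classical_set_scope.
Local Open Scope ring_scope.
Local Open Scope quotient_scope.

Lemma normc_ge0 (R : rcfType) (z : R[i]) : 0 <= normc z.
Proof. by case: z => a b; exact: sqrtr_ge0. Qed.

Section ComplexMeasurable.
Context d (Omega : measurableType d) (R : realType).
Implicit Types (f g : Omega -> R[i]) (a : R[i]).

(* This is Borel measurability for the usual topology of the complex plane. *)
Definition complex_measurable f :=
  measurable_fun setT (fun t => complex.Re (f t)) /\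
  measurable_fun setT (fun t => complex.Im (f t)).

Lemma complex_measurable0 : complex_measurable 0.
Proof. by split; exact: measurable_cst. Qed.

Lemma complex_measurableD f g :
  complex_measurable f -> complex_measurable g -> complex_measurable (f + g).
Proof.
move=> [fr fi] [gr gi]; split.
  rewrite (_ : (fun t => _) =
    (fun t => complex.Re (f t)) \+ (fun t => complex.Re (g t))).
    exact: measurable_funD.
  by apply/funext => t /=; rewrite fctE; case: (f t) (g t) => [? ?] [].
rewrite (_ : (fun t => _) =
  (fun t => complex.Im (f t)) \+ (fun t => complex.Im (g t))).
  exact: measurable_funD.
by apply/funext => t /=; rewrite fctE; case: (f t) (g t) => [? ?] [].
Qed.

Lemma complex_measurableZ a f :
  complex_measurable f -> complex_measurable (a *: f).
Proof.
move=> [fr fi]; case: a => x y; split.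
  rewrite (_ : (fun t => _) = (cst x \* (fun t => complex.Re (f t))) \-
    (cst y \* (fun t => complex.Im (f t)))).
    by apply: measurable_funB; exact: measurable_funM.
  by apply/funext => t /=; rewrite fctE; case: (f t).
rewrite (_ : (fun t => _) = (cst x \* (fun t => complex.Im (f t))) \+
  (cst y \* (fun t => complex.Re (f t)))).
  by apply: measurable_funD; exact: measurable_funM.
by apply/funext => t /=; rewrite fctE; case: (f t).
Qed.

Lemma measurable_normc f : complex_measurable f ->
  measurable_fun setT (fun t => normc (f t)).
Proof.
case=> mr mi.
rewrite (_ : (fun t => _) = @Num.sqrt R \o
  ((fun t => complex.Re (f t) ^+ 2) \+ (fun t => complex.Im (f t) ^+ 2))).
  apply: measurableT_comp; last first.
    by apply: measurable_funD; exact: measurable_funX.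
  by apply: continuous_measurable_fun; exact: sqrt_continuous.
by apply/funext => t /=; case: (f t).
Qed.

End ComplexMeasurable.

Section ComplexLnorm.
Context d (Omega : measurableType d) (R : realType).
Variables (mu : {measure set Omega -> \bar R}) (p : R).
Implicit Types (f g : Omega -> R[i]) (a : R[i]).

Definition complex_Lnorm f : \bar R :=
  Lnorm mu p%:E (fun t => (normc (f t))%:E).

Lemma complex_Lnorm_ge0 f : (0 <= complex_Lnorm f)%E.
Proof. exact: Lnorm_ge0. Qed.

Hypothesis p1 : 1 <= p.

Let p0 : 0 < p. Proof. exact: lt_le_trans p1. Qed.

Lemma complex_Lnorm0 : complex_Lnorm 0 = 0%E.
Proof.
rewrite /complex_Lnorm (_ : (fun t => _) = cst 0%E) ?Lnorm0 //.
  by rewrite eqe gt_eqF.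
by apply/funext => t; congr EFin; exact: normc0.
Qed.

Lemma le_complex_LnormD f g :
  complex_measurable f -> complex_measurable g ->
  (complex_Lnorm (f + g)%R <= complex_Lnorm f + complex_Lnorm g)%E.
Proof.
move=> mf mg; have mD := complex_measurableD mf mg.
have := @minkowski_EFin _ _ _ mu _ _ _
  (measurable_normc mf) (measurable_normc mg) p1.
apply: le_trans; rewrite /complex_Lnorm unlock.
have mabs (h : Omega -> R) : measurable_fun setT h ->
    measurable_fun setT (fun t => (`|h t| `^ p)%:E).
  move=> mh; apply/measurable_EFinP.
  apply/(@measurableT_comp _ _ _ _ _ _ (@powR R ^~ p)) => //.
  exact: measurableT_comp.
apply: gt0_ler_poweR.
- by rewrite invr_ge0 ltW.
- by rewrite in_itv/= leey integral_ge0.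
- by rewrite in_itv/= leey integral_ge0.
apply: ge0_le_integral => //.
- by move=> t _; exact: poweR_ge0.
- exact: (mabs (fun t => normc ((f + g) t)) (measurable_normc mD)).
- apply: (mabs ((fun t => normc (f t)) \+ (fun t => normc (g t)))).
  by apply: measurable_funD; exact: measurable_normc.
- move=> t _ /=; rewrite lee_fin ge0_ler_powR ?nnegrE//; first exact: ltW.
  by rewrite !ger0_norm ?addr_ge0 ?normc_ge0//; exact: le_normcD.
Qed.

Lemma complex_LnormZ a f : complex_measurable f ->
  complex_Lnorm (a *: f) = ((normc a)%:E * complex_Lnorm f)%E.
Proof.
move=> mf; rewrite /complex_Lnorm unlock.
under eq_integral => t _.
  rewrite fctE normcM abse_EFin normrM poweR_EFin powRM//.
  rewrite (ger0_norm (normc_ge0 a)) EFinM; over.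
rewrite ge0_integralZl_EFin ?powR_ge0//; last first.
- apply/measurable_EFinP/(@measurableT_comp _ _ _ _ _ _ (@powR R ^~ p)) => //.
  by apply: measurableT_comp => //; exact: measurable_normc.
rewrite poweRM ?lee_fin ?powR_ge0 ?integral_ge0//.
by rewrite poweR_EFin -powRrM mulfV ?gt_eqF// powRr1 ?normc_ge0.
Qed.

Lemma complex_Lnorm_eq0 f : complex_measurable f ->
  complex_Lnorm f = 0%E -> \forall t \ae mu, f t = 0.
Proof.
move=> mf /Lnorm_eq0_eq0 h.
have {h} : (fun t => (normc (f t))%:E) = \0%E %[ae mu].
  by apply: h => //; exact/measurable_EFinP/measurable_normc.
by apply: filterS => t /(_ I) [/eq0_normc].
Qed.

Lemma ae0_complex_Lnorm f : complex_measurable f ->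
  (\forall t \ae mu, f t = 0) -> complex_Lnorm f = 0%E.
Proof.
move=> mf f0; rewrite /complex_Lnorm unlock.
rewrite (_ : (\int[mu]_x _)%E = 0%E) ?poweR0r ?invr_neq0 ?gt_eqF//.
rewrite -(integral0 mu setT); apply: ae_eq_integral => //.
  apply/measurable_EFinP/(@measurableT_comp _ _ _ _ _ _ (@powR R ^~ p)) => //.
  by apply: measurableT_comp => //; exact: measurable_normc.
apply: filterS f0 => t ft _.
by rewrite ft normc0 abse0 poweR0r// gt_eqF.
Qed.

End ComplexLnorm.

Section ComplexLfunDef.
Context d (Omega : measurableType d) (R : realType).
Variables (mu : {measure set Omega -> \bar R}) (p : R).

Definition complex_Lfun : {pred Omega -> R[i]} :=
  [pred f | `[< complex_measurable f /\ (complex_Lnorm mu p f < +oo)%E >]].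

(* The proof of 1 <= p is what makes this type a vector space. *)
Record complex_LfunType (p1 : 1 <= p) := ComplexLfun {
  complex_Lfun_val :> Omega -> R[i];
  complex_Lfun_valP : complex_Lfun_val \in complex_Lfun }.

End ComplexLfunDef.

Section ComplexLspace.
Context d (Omega : measurableType d) (R : realType).
Variables (mu : {measure set Omega -> \bar R}) (p : R) (p1 : 1 <= p).

Notation Lfun := (complex_LfunType mu p1).

HB.instance Definition _ := [isSub for @complex_Lfun_val _ _ _ mu p p1].
HB.instance Definition _ := [Choice of Lfun by <:].

Lemma complex_LfunP (f : Lfun) :
  complex_measurable f /\ (complex_Lnorm mu p f < +oo)%E.
Proof. by have := complex_Lfun_valP f; rewrite inE. Qed.

Lemma complex_Lfun_submod_closed : submod_closed (complex_Lfun mu p).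
Proof.
split.
  rewrite inE; split; first exact: complex_measurable0.
  by rewrite complex_Lnorm0.
move=> a f g; rewrite !inE => -[mf lf] [mg lg].
have maf := complex_measurableZ a mf.
split; first exact: complex_measurableD.
apply: le_lt_trans (le_complex_LnormD mu p1 maf mg) _.
rewrite lte_add_pinfty// complex_LnormZ// lte_mul_pinfty//.
by rewrite lee_fin normc_ge0.
Qed.

HB.instance Definition _ := GRing.isSubmodClosed.Build _ _ (complex_Lfun mu p)
  complex_Lfun_submod_closed.
HB.instance Definition _ := [SubChoice_isSubLmodule of Lfun by <:].

Definition complex_Lnull : {pred Lfun} :=
  [pred f : Lfun | `[< \forall t \ae mu, f t = 0 >]].

Lemma complex_Lnull_submod_closed : submod_closed complex_Lnull.
Proof.
split; first by rewrite inE; exact: aeW.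
move=> a f g; rewrite !inE => f0 g0.
by apply: filterS2 f0 g0 => t ft gt; rewrite /= !fctE ft gt scaler0 addr0.
Qed.

HB.instance Definition _ := GRing.isSubmodClosed.Build _ _ complex_Lnull
  complex_Lnull_submod_closed.

(* L^p(Omega, mu) over the complex numbers: p-integrable functions modulo
   functions vanishing almost everywhere. *)
Definition complex_Lspace := Quotient.quot complex_Lnull.
HB.instance Definition _ := GRing.Zmodule.on complex_Lspace.
HB.instance Definition _ := EqQuotient.on complex_Lspace.

Lemma complex_Lspace_eqP (f g : Lfun) :
  \pi_complex_Lspace f = \pi_complex_Lspace g <->
  \forall t \ae mu, f t = g t.
Proof.
have -> : (\forall t \ae mu, f t = g t) <-> f - g \in complex_Lnull.
  rewrite inE; split; apply: filterS => t /= /eqP.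
    by rewrite -subr_eq0 => /eqP.
  by rewrite [_ == _]subr_eq0 => /eqP.
by rewrite Quotient.idealrBE; split=> [->|/eqP].
Qed.

Definition complex_Lspace_scale (a : R[i]) (x : complex_Lspace) :
  complex_Lspace := \pi_complex_Lspace (a *: repr x).

Lemma pi_complex_LspaceZ a (f : Lfun) :
  \pi_complex_Lspace (a *: f) = complex_Lspace_scale a (\pi_complex_Lspace f).
Proof.
apply/complex_Lspace_eqP.
have /complex_Lspace_eqP : \pi_complex_Lspace (repr (\pi_complex_Lspace f)) =
    \pi_complex_Lspace f by rewrite reprK.
by apply: filterS => t /= ft; rewrite !fctE ft.
Qed.

Lemma pi_complex_LspaceD (f g : Lfun) :
  \pi_complex_Lspace (f + g) = \pi_complex_Lspace f + \pi_complex_Lspace g.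
Proof. by rewrite !piE. Qed.

Fact complex_Lspace_scaleA a b x :
  complex_Lspace_scale a (complex_Lspace_scale b x) =
  complex_Lspace_scale (a * b) x.
Proof.
rewrite -[x]reprK -(pi_complex_LspaceZ b (repr x)).
by rewrite -!pi_complex_LspaceZ scalerA.
Qed.

Fact complex_Lspace_scale1 : left_id 1 complex_Lspace_scale.
Proof. by move=> x; rewrite -[x]reprK -pi_complex_LspaceZ scale1r. Qed.

Fact complex_Lspace_scaleDr : right_distributive complex_Lspace_scale +%R.
Proof.
move=> a x y; rewrite -[x]reprK -[y]reprK -pi_complex_LspaceD.
by rewrite -!pi_complex_LspaceZ -pi_complex_LspaceD scalerDr.
Qed.

Fact complex_Lspace_scaleDl x :
  {morph complex_Lspace_scale^~ x : a b / a + b}.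
Proof.
move=> a b; rewrite -[x]reprK.
by rewrite -!pi_complex_LspaceZ -pi_complex_LspaceD scalerDl.
Qed.

HB.instance Definition _ := GRing.Zmodule_isLmodule.Build R[i] complex_Lspace
  complex_Lspace_scaleA complex_Lspace_scale1
  complex_Lspace_scaleDr complex_Lspace_scaleDl.

Definition complex_Lspace_norm (x : complex_Lspace) : R :=
  fine (complex_Lnorm mu p (repr x)).

Lemma complex_Lspace_norm_pi (f : Lfun) :
  complex_Lspace_norm (\pi_complex_Lspace f) = fine (complex_Lnorm mu p f).
Proof.
have le_ae (g h : Lfun) : (\forall t \ae mu, g t = h t) ->
    (complex_Lnorm mu p g <= complex_Lnorm mu p h)%E.
  move=> gh; have [[mg _] [mh _]] := (complex_LfunP g, complex_LfunP h).
  have [mB _] := complex_LfunP (g - h).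
  have g0 : complex_Lnorm mu p (g - h) = 0%E.
    apply: (ae0_complex_Lnorm p1 mB).
    by apply: filterS gh => t e; rewrite -[LHS]/(g t - h t) e subrr.
  by rewrite -(subrK h g) -[leRHS]add0e -g0; exact: le_complex_LnormD.
rewrite /complex_Lspace_norm; congr fine; apply/eqP; rewrite eq_le.
have /complex_Lspace_eqP e : \pi_complex_Lspace (repr (\pi_complex_Lspace f)) =
    \pi_complex_Lspace f by rewrite reprK.
by rewrite !le_ae//; apply: filterS e => t ->.
Qed.

Let normE (f : Lfun) :
  (fine (complex_Lnorm mu p f))%:E = complex_Lnorm mu p f.
Proof.
by rewrite fineK// ge0_fin_numE ?complex_Lnorm_ge0//; case: (complex_LfunP f).
Qed.

Fact complex_Lspace_normD x y : complex_Lspace_norm (x + y) <=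
  complex_Lspace_norm x + complex_Lspace_norm y.
Proof.
rewrite -[x]reprK -[y]reprK -pi_complex_LspaceD !complex_Lspace_norm_pi.
rewrite -lee_fin EFinD !normE; apply: le_complex_LnormD => //.
- by case: (complex_LfunP (repr x)).
- by case: (complex_LfunP (repr y)).
Qed.

Lemma complex_Lspace_normZ a (x : complex_Lspace) :
  complex_Lspace_norm (a *: x) = normc a * complex_Lspace_norm x.
Proof.
rewrite -[x]reprK [_ *: _](esym (pi_complex_LspaceZ a _)).
rewrite !complex_Lspace_norm_pi; apply: EFin_inj; rewrite EFinM !normE.
by apply: complex_LnormZ => //; case: (complex_LfunP (repr x)).
Qed.

Fact complex_Lspace_norm_eq0 x : complex_Lspace_norm x = 0 -> x = 0.
Proof.
rewrite -[x]reprK complex_Lspace_norm_pi => n0.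
have x0 : complex_Lnorm mu p (repr x) = 0%E by rewrite -normE n0.
have [mx _] := complex_LfunP (repr x).
rewrite (proj2 (complex_Lspace_eqP (repr x) 0) _) ?piE//.
exact: complex_Lnorm_eq0 x0.
Qed.

Fact complex_Lspace_normMn x n :
  complex_Lspace_norm (x *+ n) = complex_Lspace_norm x *+ n.
Proof.
rewrite -scaler_nat complex_Lspace_normZ -[RHS]mulr_natl; congr (_ * _).
by rewrite (normcMn (1 : Rcomplex R)) normc1.
Qed.

Fact complex_Lspace_normN x : complex_Lspace_norm (- x) = complex_Lspace_norm x.
Proof. by rewrite -scaleN1r complex_Lspace_normZ normcN normc1 mul1r. Qed.

HB.instance Definition _ := Num.Zmodule_isNormed.Build R complex_Lspace
  complex_Lspace_normD complex_Lspace_norm_eq0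
  complex_Lspace_normMn complex_Lspace_normN.

End ComplexLspace.

Section BoundedOperators.
Context (R : realType) (X : normedZmodType R).
Implicit Types T : X -> X.

Definition bounded_operator T := exists M : R, forall x, `|T x| <= M * `|x|.

Definition operator_norm T : R := sup [set `|T x| | x in [set x | `|x| <= 1]].

Definition absolutely_Cesaro_bounded T := exists2 C : R, 0 < C & forall x,
  (ereal_sup [set (n%:R^-1 * \sum_(k < n) `|iter k T x|)%:E
    | n in [set n | (0 < n)%N]] <= (C * `|x|)%:E)%E.

End BoundedOperators.

(* Main.v *)
Require Import Defs.
From mathcomp Require Import all_boot all_order all_algebra.
From mathcomp Require Import all_classical all_reals all_analysis.
From mathcomp Require Import complex.
From mathcomp Require Import measurable_realfun ring_quotient lra zify.
Import Order.TTheory GRing.Theory Num.Theory.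
Import numFieldNormedType.Exports.
Import Normc.
Local Open Scope classical_set_scope.
Local Open Scope ring_scope.
Local Open Scope quotient_scope.

(** Write Q(x_1, ..., x_n) for the L^p norm of the square function
  (\sum |x_i|^2)^(1/2).  By Khintchine's inequality Q is comparable with the
  mean of the norm of \sum e_i x_i over random signs e_i, so applying the
  Cesaro bound to these sums gives \sum_(k < M) Q(T^k S) <= D M Q(S) for every
  finite family S.  Moreover Q^p' is subadditive and Q^p'' superadditive under
  concatenation of families (type p' and cotype p'' of L^p).

  Fix x and let F(I) = Q(T^j x : j in I).  By Markov's inequality there are sets
  G, K of density at least 7/8 in [0, N) such that |T^j x| <= 8 D |x| on G and
  F(G + k) <= 8 D F(G) <= 64 D^2 N^(1/p') |x| for k in K.  Every m in [N/2, N) is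
  of the form j + k with (j, k) in G x K in at least N/4 ways, so superadditivity
  yields \sum_(N/2 <= m < N) |T^m x|^p'' <= C N^(p''/p') |x|^p'', and the dyadic
  blocks add up.

  For the power bound let B_s be the set of n - i with 2^s <= i < 2^(s+1).  If W
  is a subset of B_s, then n lies in |W| of the translates W + k, k < 2^(s+1),
  whence F(W) >= |W| |T^n x| / (D 2^(s+1)).  For an average k in K the set G + k
  fills a fixed proportion of about log n of the blocks B_s, so superadditivity
  gives log n |T^n x|^p'' <= C F(G + k)^p'' <= C n^(p''/p') |x|^p''. *)

(** * Counting in an abstract setting *)

Section PowerAux.
Context {R : realType}.
Implicit Types a b r : R.

Lemma le_powR_base a b r : 0 <= r -> 0 <= a -> a <= b -> a `^ r <= b `^ r.
Proof.
move=> r0 a0 ab; apply: ge0_ler_powR => //; rewrite nnegrE //.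
exact: le_trans ab.
Qed.

Lemma powR_base_le a b r : 0 < r -> 0 <= b -> a `^ r <= b `^ r -> a <= b.
Proof.
move=> r0 b0; apply: contraTT; rewrite -!ltNge => ba.
by apply: gt0_ltr_powR => //; rewrite nnegrE// ltW// (le_lt_trans b0).
Qed.

Lemma powR_invK a r : 0 <= a -> r != 0 -> (a `^ r^-1) `^ r = a.
Proof. by move=> a0 r0; rewrite -powRrM mulVf// powRr1. Qed.

Lemma powRK a r : 0 <= a -> r != 0 -> (a `^ r) `^ r^-1 = a.
Proof. by move=> a0 r0; rewrite -powRrM mulfV// powRr1. Qed.

(** The left side is nonpositive when theta <= eta; otherwise theta^(r-1) >= eta^(r-1). This turns a
    lower bound on a sum of densities into one on the sum of their r-th powers, with a loss of [eta]
    per term. *)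
Lemma powR_ge_affine (eta theta r : R) :
  1 <= r -> 0 < eta -> 0 <= theta ->
  eta `^ (r - 1) * (theta - eta) <= theta `^ r.
Proof.
move=> r1 e0 t0; have [te|/ltW et] := lerP theta eta.
  by apply: le_trans (powR_ge0 _ _); rewrite mulr_ge0_le0 ?powR_ge0// subr_le0.
have t1 : 0 < theta by exact: lt_le_trans et.
have -> : theta `^ r = theta `^ (r - 1) * theta.
  by rewrite mulrC mulr_powRB1 // (lt_le_trans ltr01).
apply: ler_pM; rewrite ?powR_ge0 ?subr_ge0//.
  by apply: le_powR_base; rewrite ?subr_ge0// ltW.
by rewrite gerBl ltW.
Qed.

End PowerAux.

(** Markov's inequality at eight times the mean. *)
Lemma count_large_mean {R : realType} (u : nat -> R) (N : nat) (v : R) :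
  (forall k, 0 <= u k) -> 0 <= v -> \sum_(0 <= k < N) u k <= N%:R * v ->
  (8 * count (fun k => ~~ (u k <= 8 * v)%R) (index_iota 0 N) <= N)%N.
Proof.
move=> u0 v0 uv; set a := fun k => _.
have le : (8 * v) * (count a (index_iota 0 N))%:R <= N%:R * v.
  apply: le_trans uv; rewrite -sum1_count natr_sum mulr_sumr big_mkcond /=.
  apply: ler_sum => k _; case: ifP => // /negP; rewrite mulr1 => h.
  by rewrite ltW// ltNge; apply/negP.
(* For v = 0 one cannot divide by v, but then every u k with k < N vanishes and the count is 0. *)
move: v0; rewrite le_eqVlt => /predU1P[v0|v0]; last first.
  rewrite -(ler_nat R) -(ler_pM2r v0); apply: le_trans le.
  by rewrite natrM mulrAC.
rewrite (_ : count a _ = 0%N) ?muln0//; apply/eqP; rewrite -leqn0 leqNgt -has_count.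
apply/hasP => -[k ks]; rewrite /a -v0 mulr0; apply/negP; rewrite negbK.
move: uv; rewrite -v0 mulr0; apply: le_trans.
by rewrite (big_rem k)//= lerDl sumr_ge0.
Qed.

(** Each m in [N/2, N) has m + 1 >= N/2 decompositions m = (m - k) + k. At most N/8 of them fail
    through [K] and at most N/8 through [G], so at least N/4 are counted on the right. *)
Lemma convolution_lower_bound {R : realType} (G K : pred nat) (w : nat -> R)
    (N : nat) :
  (forall m, 0 <= w m) ->
  (8 * count (predC G) (index_iota 0 N) <= N)%N ->
  (8 * count (predC K) (index_iota 0 N) <= N)%N ->
  N%:R / 4 * \sum_(N./2 <= m < N) w m <=
  \sum_(0 <= k < N | K k) \sum_(0 <= j < N | G j) w (j + k)%N.
Proof.
move=> w0 hG hK.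
have inner k : \sum_(N./2 <= m < N) ((k <= m)%N && G (m - k)%N)%:R * w m <=
    \sum_(0 <= j < N | G j) w (j + k)%N.
  (* The summand in the variable m = j + k, extended by 0 to m < k, so that the range can be cut
     down to [N/2, N). *)
  set h := fun m => ((k <= m)%N && G (m - k)%N)%:R * w m.
  have h0 m : 0 <= h m by rewrite mulr_ge0.
  have -> : \sum_(0 <= j < N | G j) w (j + k)%N = \sum_(0 <= i < N + k) h i.
    rewrite [RHS](@big_cat_nat _ _ _ k)//= ?leq_addl//.
    rewrite [X in _ = X + _]big_nat_cond [X in _ = X + _]big1 ?add0r; last first.
      by move=> i /andP[/andP[_ ik] _]; rewrite /h leqNgt ik mul0r.
    rewrite -{2}(add0n k) [RHS]big_addn addnK big_mkcond.
    apply: eq_bigr => j _; rewrite /h leq_addl addnK /=.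
    by case: (G j); rewrite ?mul1r ?mul0r.
  rewrite [leRHS](@big_cat_nat _ _ _ N)//= ?leq_addr//.
  rewrite [X in _ <= X + _](@big_cat_nat _ _ _ N./2)//=; last by lia.
  by rewrite addrAC lerDr addr_ge0// sumr_ge0.
have cnt m : (N./2 <= m < N)%N ->
    N%:R / 4 <= \sum_(0 <= k < N | K k) (((k <= m)%N && G (m - k)%N)%:R : R).
  move=> /andP[m1 m2].
  rewrite -natr_sum ler_pdivrMr// -natrM ler_nat.
  rewrite (@big_cat_nat _ _ _ m.+1)//= mulnDl; apply: leq_trans (leq_addr _ _).
  rewrite [X in (X * _)%N](_ : _ =
    count (fun k => K k && G (m - k)%N) (index_iota 0 m.+1)); last first.
    rewrite -sum1_count big_mkcondr /= big_nat_cond [RHS]big_nat_cond.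
    apply: eq_bigr => i /andP[/andP[_ im] _]; rewrite -ltnS im /=.
    by case: (G _).
  have h1 : (m.+1 <= count (fun k => K k && G (m - k)%N) (index_iota 0 m.+1)
      + count (predC K) (index_iota 0 m.+1)
      + count (fun k => ~~ G (m - k)%N) (index_iota 0 m.+1))%N.
    rewrite -[X in (X <= _)%N](_ : size (index_iota 0 m.+1) = m.+1); last first.
      by rewrite size_iota subn0.
    elim: (index_iota 0 m.+1) => //= a s IH.
    by case: (K a) => /=; case: (G (m - a)%N) => /=; lia.
  have h2 (P : pred nat) : (count P (index_iota 0 m.+1) <= count P (index_iota 0 N))%N.
    by rewrite /index_iota !subn0 -(subnKC m2) iotaD count_cat leq_addr.
  (* Reflection i -> m - i of the interval [0, m]. *)
  have h3 : count (fun k => ~~ G (m - k)%N) (index_iota 0 m.+1) =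
      count (predC G) (index_iota 0 m.+1).
    rewrite -!sum1_count big_mkcond [RHS]big_mkcond big_nat_rev /=.
    rewrite big_nat_cond [RHS]big_nat_cond; apply: eq_bigr => i /andP[/andP[_ im] _].
    by rewrite add0n subSS subKn// -ltnS.
  have h4 := h2 (predC K); have h5 := h2 (predC G); rewrite h3 in h1; lia.
apply: (@le_trans _ _ (\sum_(0 <= k < N | K k)
    \sum_(N./2 <= m < N) ((k <= m)%N && G (m - k)%N)%:R * w m)); last exact: ler_sum.
rewrite exchange_big /= mulr_sumr.
apply: ler_sum_nat => m mN; rewrite -mulr_suml.
by rewrite ler_wpM2r// cnt.
Qed.

(** [S] is the number of dyadic blocks of distances to n used later. The hypothesis 3 <= n gives S
    >= 1, hence S + 2 <= 3 S, which makes [S] comparable with log n. *)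
Lemma trunc_log_half (n : nat) (S := trunc_log 2 (n.+1)./2) : (3 <= n)%N ->
  [/\ (S.+2 <= 3 * S)%N, (2 ^ S <= (n.+1)./2)%N & (n <= 2 ^ S.+2)%N].
Proof.
move=> n3; have S1 : (1 <= S)%N by apply: trunc_log_max => //=; lia.
split; first by lia.
- by apply: trunc_logP => //; lia.
- by have := @trunc_log_ltn 2 (n.+1)./2 isT; rewrite -/S !expnS; lia.
Qed.

(* [F I] stands for the square norm of the vectors T^j x, j \in I. *)
Section Combinatorics.
Context {R : realType}.
Variables (F : seq nat -> R) (r t D : R).
Hypotheses (t1 : 1 <= t) (tr : t <= r) (D0 : 0 < D).
Hypotheses (F0 : forall I, 0 <= F I) (Fnil : F [::] = 0).
Hypothesis Fperm : forall I J, perm_eq I J -> F I = F J.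
Hypothesis Fsub : forall I J, F (I ++ J) `^ t <= F I `^ t + F J `^ t.
Hypothesis Fsup : forall I J, F I `^ r + F J `^ r <= F (I ++ J) `^ r.
Hypothesis Fces : forall I M,
  \sum_(0 <= k < M) F [seq (j + k)%N | j <- I] <= D * M%:R * F I.

Let t0 : 0 < t. Proof. exact: lt_le_trans t1. Qed.
Let r1 : 1 <= r. Proof. exact: le_trans tr. Qed.
Let r0 : 0 < r. Proof. exact: lt_le_trans r1. Qed.

(** Iterating [Fsub] over singletons gives F(I)^t <= |I| B^t. *)
Lemma F_le_size I B : 0 <= B -> (forall j, j \in I -> F [:: j] <= B) ->
  F I <= (size I)%:R `^ t^-1 * B.
Proof.
move=> B0 h; apply: (@powR_base_le _ _ _ t) => //.
  by rewrite mulr_ge0 ?powR_ge0.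
rewrite powRM ?powR_ge0// powR_invK ?gt_eqF//.
elim: I h => [|a I IH] h; first by rewrite Fnil powR0 ?gt_eqF// mul0r.
rewrite -cat1s; apply: le_trans (Fsub _ _) _; rewrite /= -addn1 natrD mulrDl mul1r addrC.
apply: lerD; first by apply: IH => j jI; rewrite h// inE jI orbT.
by apply: le_powR_base; rewrite ?F0 ?h ?mem_head// ltW.
Qed.

Lemma sum_powR_le_F I : \sum_(j <- I) F [:: j] `^ r <= F I `^ r.
Proof.
elim: I => [|a I IH]; first by rewrite big_nil powR_ge0.
by rewrite big_cons -[in leRHS]cat1s; apply: le_trans (Fsup _ _); rewrite lerD2l.
Qed.

(** Superadditivity of F^r implies monotonicity, since the r-th power of the remaining part is
    nonnegative. *)
Lemma F_perm_cat_le I J L : perm_eq L (I ++ J) -> F I <= F L.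
Proof.
move=> /Fperm ->; apply: (@powR_base_le _ _ _ r) => //.
by apply: le_trans (Fsup _ _); rewrite lerDl powR_ge0.
Qed.

Lemma F_filter_le (P : pred nat) I : F [seq j <- I | P j] <= F I.
Proof.
apply: (@F_perm_cat_le _ [seq j <- I | predC P j]).
by rewrite perm_sym perm_filterC.
Qed.

Lemma F_mem_le n I : n \in I -> F [:: n] <= F I.
Proof.
by move=> nI; apply: (@F_perm_cat_le _ (rem n I)); exact: perm_to_rem.
Qed.

(** The level sets of [key] split [I] into disjoint parts, so [Fsup] applies repeatedly; entries
    with key at least m are dropped by monotonicity. *)
Lemma F_blocks_le (key : nat -> nat) m I :
  \sum_(0 <= s < m) F [seq j <- I | key j == s] `^ r <= F I `^ r.
Proof.
suff h : \sum_(0 <= s < m) F [seq j <- I | key j == s] `^ r <=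
    F [seq j <- I | (key j < m)%N] `^ r.
  by apply: le_trans h _; apply: le_powR_base; rewrite ?F_filter_le// ltW.
elim: m => [|m IH]; first by rewrite big_nil powR_ge0.
rewrite big_nat_recr//=; apply: (@le_trans _ _
  (F [seq j <- I | (key j < m)%N] `^ r + F [seq j <- I | key j == m] `^ r)).
  by rewrite lerD2r.
apply: le_trans (Fsup _ _) _; rewrite le_eqVlt; apply/orP; left; apply/eqP.
congr (_ `^ _); apply: Fperm.
rewrite perm_sym -(perm_filterC (fun j => (key j < m)%N)) -!filter_predI.
rewrite (@eq_filter _ (predI _ _) (fun j => (key j < m)%N)); last first.
  by move=> j /=; lia.
rewrite (@eq_filter _ (predI _ _) (fun j => (key j == m)%N)) //.
by move=> j /=; lia.
Qed.

(** Markov's inequality is used twice: on the orbit, which yields [G], and then on the translates of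
    [G], which yields [K]. Each use costs a factor 8 D, and |G| <= N gives the power of N. *)
Lemma large_good_sets N : exists G K : pred nat,
  [/\ (8 * count (predC G) (index_iota 0 N) <= N)%N,
      (8 * count (predC K) (index_iota 0 N) <= N)%N &
      forall k, K k -> F [seq (j + k)%N | j <- index_iota 0 N & G j] <=
        64 * D ^+ 2 * N%:R `^ t^-1 * F [:: 0%N]].
Proof.
pose G k := F [:: k] <= 8 * (D * F [:: 0%N]).
pose I := [seq j <- index_iota 0 N | G j].
pose K k := F [seq (j + k)%N | j <- I] <= 8 * (D * F I).
exists G, K; split.
- apply: count_large_mean => //; first by rewrite mulr_ge0// ltW.
  by have := Fces [:: 0%N] N; rewrite mulrCA mulrA.
- apply: (@count_large_mean _ (fun k => F [seq (j + k)%N | j <- I])) => //.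
    by rewrite mulr_ge0// ltW.
  by have := Fces I N; rewrite mulrCA mulrA.
move=> k Kk; apply: le_trans Kk _.
have B0 : 0 <= 8 * (D * F [:: 0%N]) by rewrite !mulr_ge0// ltW.
have FI : F I <= N%:R `^ t^-1 * (8 * (D * F [:: 0%N])).
  apply: le_trans (@F_le_size I (8 * (D * F [:: 0%N])) _ _) _.
  - by [].
  - by move=> j; rewrite mem_filter => /andP[].
  - rewrite ler_wpM2r//.
    apply: le_powR_base => //; first by rewrite invr_ge0 ltW.
    rewrite ler_nat.
    by rewrite size_filter (leq_trans (count_size _ _))// size_iota subn0.
apply: (@le_trans _ _ (8 * (D * (N%:R `^ t^-1 * (8 * (D * F [:: 0%N])))))).
  by rewrite !ler_pM2l.
rewrite le_eqVlt; apply/orP; left; apply/eqP.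
by rewrite expr2; lra.
Qed.

(** For each k in [K], superadditivity bounds the sum over the translate G + k by B^r. Summing over
    at most N such k and dividing by the multiplicity N/4 leaves 4 B^r. *)
Lemma half_block_sum N :
  \sum_(N./2 <= m < N) F [:: m] `^ r <=
  4 * (64 * D ^+ 2) `^ r * N%:R `^ (r / t) * F [:: 0%N] `^ r.
Proof.
have [->|N0] := posnP N.
  by rewrite big_geq// !mulr_ge0 ?powR_ge0.
have [G [K [hG hK hF]]] := large_good_sets N.
have := @convolution_lower_bound R G K (fun m => F [:: m] `^ r) N
  (fun m => powR_ge0 _ _) hG hK.
set S := \sum_(_ <= m < _) _; set B := 64 * D ^+ 2 * N%:R `^ t^-1 * F [:: 0%N] in hF *.
have B0 : 0 <= B by rewrite !mulr_ge0 ?powR_ge0 ?exprn_ge0// ltW.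
move=> h; have {}h : N%:R / 4 * S <= N%:R * B `^ r.
  apply: le_trans h _; apply: (@le_trans _ _ (\sum_(0 <= k < N | K k) B `^ r)).
    apply: ler_sum => k Kk; apply: (@le_trans _ _
      (F [seq (j + k)%N | j <- index_iota 0 N & G j] `^ r)).
      by apply: le_trans (sum_powR_le_F _); rewrite big_map big_filter.
    by apply: le_powR_base; rewrite ?hF// ltW.
  rewrite big_mkcond; apply: (@le_trans _ _ (\sum_(0 <= k < N) B `^ r)).
    by apply: ler_sum => k _; case: ifP => // _; exact: powR_ge0.
  by rewrite sumr_const_nat subn0 mulr_natl.
have N0' : 0 < N%:R :> R by rewrite ltr0n.
have {}h : S <= 4 * B `^ r.
  by rewrite -(ler_pM2l N0'); lra.
have a0 : 0 <= 64 * D ^+ 2 by rewrite mulr_ge0 ?exprn_ge0// ltW.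
move: a0 h; rewrite /B; move: (64 * D ^+ 2) => a a0 h; apply: le_trans h _.
rewrite !powRM ?mulr_ge0 ?powR_ge0 ?F0//.
by rewrite -powRrM (mulrC t^-1) !mulrA.
Qed.

(** Strong induction on N, splitting at N/2. As r/t >= 1, halving N at least halves N^(r/t), and the
    constants close up as 8/2 + 4 = 8. *)
Lemma cesaro_powR_sum N :
  \sum_(0 <= m < N) F [:: m] `^ r <=
  8 * (64 * D ^+ 2) `^ r * N%:R `^ (r / t) * F [:: 0%N] `^ r.
Proof.
elim/ltn_ind: N => N IH.
have [->|N0] := posnP N.
  by rewrite big_geq// !mulr_ge0 ?powR_ge0.
rewrite (@big_cat_nat _ _ _ N./2)//=; last by lia.
have N2 : (N./2 < N)%N by lia.
have := IH _ N2; have := half_block_sum N.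
set S1 := \sum_(_ <= m < _) _; set S2 := \sum_(_ <= m < _) _.
set a := (_ * _ ^+ 2) `^ r; set b := N%:R `^ _; set b2 := _%:R `^ (_ / _); set c := _ `^ _.
move=> h1 h2.
have hb : b2 <= b / 2.
  have q1 : 1 <= r / t by rewrite ler_pdivlMr// mul1r.
  apply: (@le_trans _ _ ((N%:R / 2) `^ (r / t))).
    apply: le_powR_base => //; first by rewrite (le_trans _ q1).
    by rewrite ler_pdivlMr// -natrM ler_nat; lia.
  rewrite powRM// ?invr_ge0//.
  rewrite ler_wpM2l ?powR_ge0//; apply: ge1r_powR => //.
  by rewrite invr_gt0 ltr0n /= invf_le1// ler1n.
have ac0 : 0 <= a * c by rewrite mulr_ge0 ?powR_ge0.
have hb' := ler_wpM2l ac0 hb.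
apply: le_trans (lerD h2 h1) _.
suff -> : 8 * a * b2 * c + 4 * a * b * c <= 8 * a * b * c by [].
by rewrite -subr_ge0; move: hb'; rewrite -subr_ge0 => hb'; lra.
Qed.

(** The block [2^s, 2^(s+1)) holds 2^s integers of weight 2^-(s+1) and so contributes 1/2. *)
Lemma dyadic_weight_sum (S : nat) :
  \sum_(1 <= i < 2 ^ S) (2 ^+ (trunc_log 2 i).+1)^-1 = S%:R / 2 :> R.
Proof.
elim: S => [|S IH]; first by rewrite big_geq// mul0r.
rewrite (@big_cat_nat _ _ _ (2 ^ S))//=; last 2 first.
- by rewrite expn_gt0.
- by rewrite leq_exp2l.
rewrite IH (_ : \sum_(_ <= i < _) _ = 2^-1).
  by rewrite -[in RHS]natr1 mulrDl mul1r.
rewrite (eq_big_nat _ _ (F2 := fun=> (2 ^+ S.+1)^-1)); last first.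
  by move=> i ib; rewrite (@trunc_log_eq 2 S).
rewrite sumr_const_nat expnS mul2n -addnn addnK -[LHS]mulr_natl natrX.
by rewrite exprS invfM mulrCA mulfV ?mulr1// expf_neq0.
Qed.

(** Among the translates W + i with i < 2^s, those with n - i in [W] contain n, and there are |W| of
    them. Each has F at least F(n), so [Fces] bounds |W| F(n) by D 2^s F(W). *)
Lemma F_block_ge n (s : nat) W : uniq W ->
  {in W, forall j, (j < n)%N && (n - j < 2 ^ s)%N} ->
  (size W)%:R / 2 ^+ s * F [:: n] <= D * F W.
Proof.
move=> uW hW; rewrite mulrAC ler_pdivrMr ?exprn_gt0//.
rewrite mulrAC -natrX; apply: le_trans (Fces _ _).
pose P i := (i <= n)%N && ((n - i)%N \in W).
apply: (@le_trans _ _ (\sum_(0 <= i < 2 ^ s | P i) F [:: n])); last first.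
  rewrite [leLHS]big_mkcond; apply: ler_sum => i _; case: ifP => // /andP[i1 i2].
  by apply: F_mem_le; apply/mapP; exists (n - i)%N => //; rewrite subnK.
rewrite big_const_seq iter_addr_0 -[leRHS]mulr_natl ler_wpM2r// ler_nat.
rewrite -size_filter -(size_map (fun j => (n - j)%N) W).
apply: uniq_leq_size.
  rewrite map_inj_in_uniq// => i j /hW/andP[i1 _] /hW/andP[j1 _]; lia.
move=> i /mapP[j jW ->]; have /andP[j1 j2] := hW _ jW.
by rewrite mem_filter /P mem_index_iota j2 leq_subr subKn ?jW// ltnW.
Qed.

(** The translates of [G] by k in [K] have, on average, density bounded below in the S dyadic blocks
    of distances to n. [F_block_ge] bounds F from below on each block, and [F_blocks_le] adds up the
    r-th powers. *)
Lemma F_log_growth n (S : nat) : (0 < n)%N -> (2 ^ S <= (n.+1)./2)%N ->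
  S%:R * F [:: n] `^ r <=
  (16 * D * (64 * D ^+ 2 * n%:R `^ t^-1 * F [:: 0%N])) `^ r.
Proof.
move=> n0 Sn.
have [G [K [hG hK hF]]] := large_good_sets n.
set B := 64 * D ^+ 2 * n%:R `^ t^-1 * F [:: 0%N] in hF *.
have B0 : 0 <= B by rewrite !mulr_ge0 ?powR_ge0 ?exprn_ge0// ltW.
(* The dyadic block of the distance n - j. A translate may reach beyond n; the default S keeps such
   points out of the blocks s < S. *)
pose key j := if (j < n)%N then trunc_log 2 (n - j) else S.
pose w j : R := if (key j < S)%N then (2 ^+ (key j).+1)^-1 else 0.
have w0 j : 0 <= w j by rewrite /w; case: ifP => // _; rewrite invr_ge0 exprn_ge0.
have hconv := @convolution_lower_bound R G K w n w0 hG hK.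
pose I k := [seq (j + k)%N | j <- index_iota 0 n & G j].
pose W k s := [seq j <- I k | key j == s].
have uI k : uniq (I k).
  rewrite map_inj_in_uniq; first by rewrite filter_uniq// iota_uniq.
  by move=> i j _ _ /eqP; rewrite eqn_add2r => /eqP.
(* The denominator is the number of translates that [F_block_ge] uses; [w] is the matching weight of
   one point. *)
pose th k s : R := (size (W k s))%:R / 2 ^+ s.+1.
have th0 k s : 0 <= th k s by rewrite divr_ge0// exprn_ge0.
have wth k : \sum_(0 <= j < n | G j) w (j + k)%N = \sum_(0 <= s < S) th k s.
  rewrite /th /W; under [RHS]eq_bigr do
    rewrite size_filter -sum1_count natr_sum mulr_suml big_mkcond.
  rewrite exchange_big /= big_map big_filter; apply: eq_bigr => j _.
  rewrite /w; case: ifPn => kS.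
    rewrite (bigD1_seq (key (j + k)%N)) ?iota_uniq ?mem_index_iota//=.
    rewrite eqxx mul1r big1_seq ?addr0// => s /andP[/negPf sj _].
    by rewrite eq_sym sj.
  rewrite big_nat_cond big1// => s /andP[/andP[_ sS] _].
  by case: eqP => // ks; move: kS; rewrite ks sS.
(* In terms of the distance i = n - m the range is 1 <= i <= (n+1)/2, which contains 1 <= i <
   2^S. *)
have hw : S%:R / 2 <= \sum_(n./2 <= m < n) w m.
  rewrite -dyadic_weight_sum [leRHS]big_nat_rev big_add1 /=.
  rewrite -{1}(add0n n./2) big_addn.
  rewrite [leRHS](@big_cat_nat _ _ _ (2 ^ S).-1)//=; last by lia.
  apply: ler_wpDr; first exact: sumr_ge0.
  apply: ler_sum_nat => i /andP[_ iS].
  have -> : (n./2 + n - (i + n./2).+1 = n - i.+1)%N by lia.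
  rewrite /w /key (_ : (n - i.+1 < n)%N); last by lia.
  have i1n : (i.+1 <= n)%N by lia.
  rewrite subKn// (_ : (trunc_log 2 i.+1 < S)%N)//.
  rewrite -(ltn_exp2l _ _ (ltnSn 1)); apply: leq_ltn_trans (trunc_logP _ _) _ => //.
  by lia.
have S2 : (n%:R / 4) * (S%:R / 2) <= \sum_(0 <= k < n | K k) \sum_(0 <= s < S) th k s.
  under eq_bigr do rewrite -wth.
  by apply: le_trans hconv; rewrite ler_wpM2l.
have Dge0 : 0 <= D by exact: ltW.
have rge0 : 0 <= r by exact: ltW.
have thF k s : (s < S)%N -> F [:: n] * th k s <= D * F (W k s).
  move=> sS; rewrite mulrC; apply: F_block_ge; first by rewrite filter_uniq.
  move=> j; rewrite mem_filter => /andP[/eqP + _]; rewrite /key.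
  case: ifPn => [jn <-|_ Ss]; last by rewrite Ss ltnn in sS.
  by rewrite trunc_log_ltn.
(* The total density is at least n S / 8; discarding [eta] for each of at most n S pairs (k, s)
   still leaves n S / 16. *)
pose eta : R := 16^-1.
have eta0 : 0 < eta by rewrite invr_gt0.
have blk k : K k -> \sum_(0 <= s < S) F [:: n] `^ r * th k s `^ r <= (D * B) `^ r.
  move=> Kk; apply: (@le_trans _ _ (\sum_(0 <= s < S) D `^ r * F (W k s) `^ r)).
    apply: ler_sum_nat => s /andP[_ sS].
    rewrite -!powRM//; apply: le_powR_base; rewrite ?thF ?mulr_ge0//.
  rewrite -mulr_sumr powRM// ler_wpM2l ?powR_ge0//.
  apply: le_trans (F_blocks_le key S (I k)) _.
  by apply: le_powR_base; rewrite // hF.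
have blk' k : K k -> F [:: n] `^ r *
    (eta `^ (r - 1) * (\sum_(0 <= s < S) th k s - S%:R * eta)) <= (D * B) `^ r.
  move=> Kk; apply: le_trans (blk _ Kk); rewrite -mulr_sumr ler_wpM2l ?powR_ge0//.
  rewrite (_ : S%:R * eta = \sum_(0 <= s < S) eta); last first.
    by rewrite sumr_const_nat subn0 mulr_natl.
  rewrite -sumrB mulr_sumr; apply: ler_sum => s _.
  exact: powR_ge_affine.
have tot : F [:: n] `^ r *
    (eta `^ (r - 1) * (n%:R / 4 * (S%:R / 2) - n%:R * (S%:R * eta))) <=
    n%:R * (D * B) `^ r.
  apply: (@le_trans _ _ (\sum_(0 <= k < n | K k) (D * B) `^ r)); last first.
    rewrite big_mkcond; apply: (@le_trans _ _ (\sum_(0 <= k < n) (D * B) `^ r)).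
      by apply: ler_sum => k _; case: ifP => // _; exact: powR_ge0.
    by rewrite sumr_const_nat subn0 mulr_natl.
  apply: (@le_trans _ _ (\sum_(0 <= k < n | K k) F [:: n] `^ r *
    (eta `^ (r - 1) * (\sum_(0 <= s < S) th k s - S%:R * eta)))); last first.
    exact: ler_sum.
  rewrite -mulr_sumr -mulr_sumr ler_wpM2l ?powR_ge0// ler_wpM2l ?powR_ge0//.
  rewrite sumrB lerB//.
  rewrite big_mkcond; apply: (@le_trans _ _ (\sum_(0 <= k < n) S%:R * eta)).
    by apply: ler_sum => k _; case: ifP => // _; rewrite mulr_ge0// ltW.
  by rewrite sumr_const_nat subn0 -[leLHS]mulr_natl.
have n0' : 0 < n%:R :> R by rewrite ltr0n.
have DB0 : 0 <= D * B by rewrite mulr_ge0// ltW.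
rewrite -/B -mulrA powRM//.
(* The factor eta^(r-1) together with the remaining 1/16 is 16^(-r), whence the 16 in the bound. *)
have e16 : eta `^ (r - 1) * eta * 16 `^ r = 1.
  rewrite [_ * eta]mulrC mulr_powRB1 ?ltW// /eta -powRM ?invr_ge0//.
  by rewrite mulVf// powR1.
rewrite -[leLHS]mul1r -[X in X * _ <= _]e16 -(ler_pM2l n0').
rewrite [leRHS]mulrCA; apply: le_trans (ler_wpM2l (powR_ge0 16 r) tot).
rewrite le_eqVlt; apply/orP; left; apply/eqP.
have -> : n%:R / 4 * (S%:R / 2) - n%:R * (S%:R * eta) = n%:R * S%:R * eta :> R.
  by rewrite /eta; lra.
by lra.
Qed.

(** Since ln n <= 3 S and 3 <= 3^r, the factor 3 is absorbed inside the r-th power, giving 48 = 3 *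
    16. *)
Lemma F_growth n : (3 <= n)%N ->
  F [:: n] * ln n%:R `^ r^-1 <=
  48 * D * (64 * D ^+ 2 * n%:R `^ t^-1 * F [:: 0%N]).
Proof.
move=> n3; set B := 64 * D ^+ 2 * n%:R `^ t^-1 * F [:: 0%N].
have -> : 48 * D * B = 3 * (16 * D * B) by lra.
have Dge0 : 0 <= D by exact: ltW.
have B0 : 0 <= 16 * D * B by rewrite !mulr_ge0 ?powR_ge0 ?exprn_ge0.
have n1 : (1 : R) <= n%:R by rewrite ler1n; lia.
have ln0 : 0 <= ln n%:R :> R by rewrite ln_ge0.
apply: (@powR_base_le _ _ _ r) => //; first by rewrite mulr_ge0.
rewrite (powRM _ (F0 _) (powR_ge0 _ _)) powR_invK ?gt_eqF// (powRM _ (ler0n _ 3) B0).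
pose S := trunc_log 2 (n.+1)./2.
have [S1 Sn nS] := trunc_log_half n n3.
have lnS : ln n%:R <= 3 * S%:R :> R.
  apply: (@le_trans _ _ (ln (2 ^+ S.+2))).
    by rewrite ler_ln ?posrE ?exprn_gt0// ?(lt_le_trans ltr01)// -natrX ler_nat.
  rewrite lnXn// -[leLHS]mulr_natl; apply: (@le_trans _ _ (S.+2%:R * 1)).
    by rewrite ler_wpM2l//; apply: (@le_ln1Dx _ 1); lra.
  by rewrite mulr1 -natrM ler_nat.
have h := @F_log_growth n S (ltn_trans (isT : 0 < 2)%N n3) Sn.
have r3 : 3 <= 3 `^ r :> R by apply: le1r_powR; rewrite ?ler1n.
apply: (@le_trans _ _ (3 * (S%:R * F [:: n] `^ r))).
  by rewrite mulrA mulrC ler_wpM2r ?powR_ge0.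
by apply: ler_pM => //; rewrite mulr_ge0 ?powR_ge0.
Qed.

End Combinatorics.

(** * Random signs and Khintchine's inequality *)

(* The mean of [phi (v + \sum_i e_i x_i)] over all choices of signs e_i. *)
Fixpoint sign_mean {R : realType} {V : zmodType} (phi : V -> R) (v : V)
    (s : seq V) : R :=
  if s is x :: s' then
    (sign_mean phi (v + x) s' + sign_mean phi (v - x) s') / 2
  else phi v.

Section SignMean.
Context {R : realType}.

Lemma sign_mean_map {U V : zmodType} (h : U -> V) (phi : V -> R) v s :
  {morph h : a b / a + b} -> {morph h : a b / a - b} ->
  sign_mean phi (h v) (map h s) = sign_mean (phi \o h) v s.
Proof. by move=> hD hB; elim: s v => //= x s IH v; rewrite -hD -hB !IH. Qed.

Lemma le_sign_mean {V : zmodType} (phi psi : V -> R) v s :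
  (forall u, phi u <= psi u) -> sign_mean phi v s <= sign_mean psi v s.
Proof.
by move=> h; elim: s v => //= x s IH v; rewrite ler_pM2r ?invr_gt0// lerD.
Qed.

Lemma sign_mean_ge0 {V : zmodType} (phi : V -> R) v s :
  (forall u, 0 <= phi u) -> 0 <= sign_mean phi v s.
Proof.
by move=> h; elim: s v => //= x s IH v; rewrite divr_ge0// addr_ge0.
Qed.

Lemma sign_meanD {V : zmodType} (phi psi : V -> R) v s :
  sign_mean (fun u => phi u + psi u) v s = sign_mean phi v s + sign_mean psi v s.
Proof. by elim: s v => //= x s IH v; rewrite !IH; lra. Qed.

Lemma sign_meanZ {V : zmodType} (c : R) (phi : V -> R) v s :
  sign_mean (fun u => c * phi u) v s = c * sign_mean phi v s.
Proof. by elim: s v => //= x s IH v; rewrite !IH; lra. Qed.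

Lemma sign_mean_sum {V : zmodType} (I : Type) (l : seq I) (phi : I -> V -> R) v s :
  sign_mean (fun u => \sum_(i <- l) phi i u) v s =
  \sum_(i <- l) sign_mean (phi i) v s.
Proof.
elim: s v => //= x s IH v; rewrite !IH -big_split mulr_suml.
by apply: eq_bigr.
Qed.

Lemma powR_convex (p x y a b : R) : 1 <= p -> 0 <= x -> x <= 1 ->
  y = 1 - x -> 0 <= a -> 0 <= b ->
  (x * a + y * b) `^ p <= x * a `^ p + y * b `^ p.
Proof.
move=> p1 x0 x1 -> a0 b0.
have := @convex_powR R p p1 (Itv01 x0 x1) a b.
by rewrite !inE/= !in_itv/= !andbT !convRE/= => ->.
Qed.

Lemma powR_midpoint (p a b : R) : 1 <= p -> 0 <= a -> 0 <= b ->
  ((a + b) / 2) `^ p <= (a `^ p + b `^ p) / 2.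
Proof.
move=> p1 a0 b0; have h : 2^-1 <= 1 :> R by lra.
have := @powR_convex p 2^-1 2^-1 a b p1 _ h _ a0 b0.
by rewrite -!mulrDr -!(mulrC 2^-1); apply; lra.
Qed.

(** Jensen's inequality, one sign at a time. *)
Lemma sign_mean_powR {V : zmodType} (p : R) (phi : V -> R) v s : 1 <= p ->
  (forall u, 0 <= phi u) ->
  sign_mean phi v s `^ p <= sign_mean (fun u => phi u `^ p) v s.
Proof.
move=> p1 h; elim: s v => //= x s IH v.
apply: le_trans (@powR_midpoint _ _ _ p1 _ _) _; rewrite ?sign_mean_ge0//.
by rewrite ler_pM2r ?invr_gt0// lerD.
Qed.

End SignMean.

Section Khintchine.
Context {R : realType}.
Implicit Types (v : R[i]) (s : seq R[i]).

Lemma normc2D (a b : R[i]) : normc (a + b) ^+ 2 + normc (a - b) ^+ 2 =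
  2 * (normc a ^+ 2 + normc b ^+ 2).
Proof.
case: a b => [a1 a2] [b1 b2] /=.
by rewrite !sqr_sqrtr ?addr_ge0 ?sqr_ge0//; lra.
Qed.

(** The left side equals 2 (|a|^2 + |b|^2)^2 + 8 <a, b>^2 for the real inner product, and
    Cauchy-Schwarz bounds the last term. *)
Lemma normc4D (a b : R[i]) : normc (a + b) ^+ 4 + normc (a - b) ^+ 4 <=
  2 * (normc a ^+ 4 + 6 * normc a ^+ 2 * normc b ^+ 2 + normc b ^+ 4).
Proof.
case: a b => [a1 a2] [b1 b2] /=.
rewrite !(exprM _ 2 2) !sqr_sqrtr ?addr_ge0 ?sqr_ge0//.
have : (a1 * b1 + a2 * b2) ^+ 2 <= (a1 ^+ 2 + a2 ^+ 2) * (b1 ^+ 2 + b2 ^+ 2).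
  have := sqr_ge0 (a1 * b2 - a2 * b1); lra.
lra.
Qed.

Definition sqsum s : R := \sum_(z <- s) normc z ^+ 2.

Lemma sqsum_ge0 s : 0 <= sqsum s.
Proof. by apply: sumr_ge0 => z _; exact: sqr_ge0. Qed.

Lemma sqsum_cons z s : sqsum (z :: s) = normc z ^+ 2 + sqsum s.
Proof. exact: big_cons. Qed.

Lemma sign_mean_normc2 v s :
  sign_mean (fun z => normc z ^+ 2) v s = normc v ^+ 2 + sqsum s.
Proof.
elim: s v => [|x s IH] v /=; first by rewrite /sqsum big_nil addr0.
by rewrite !IH sqsum_cons; have := normc2D v x; lra.
Qed.

(** The general starting point v makes the induction go through; v = 0 gives the bound 3 sigma^4. *)
Lemma sign_mean_normc4 v s : sign_mean (fun z => normc z ^+ 4) v s <=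
  normc v ^+ 4 + 6 * normc v ^+ 2 * sqsum s + 3 * sqsum s ^+ 2.
Proof.
elim: s v => [|x s IH] v /=; first by rewrite /sqsum big_nil expr0n/= !mulr0 !addr0.
rewrite sqsum_cons.
have := normc4D v x; have := normc2D v x; have := IH (v + x); have := IH (v - x).
have := sqsum_ge0 s; set A := sign_mean _ _ _; set B := sign_mean _ _ _.
move: (sqsum s) => S S0 h1 h2 h3 h4.
have h5 : 6 * normc (v + x) ^+ 2 * S + 6 * normc (v - x) ^+ 2 * S =
  12 * (normc v ^+ 2 + normc x ^+ 2) * S by rewrite -mulrDl -mulrDr h3; lra.
have e : normc x ^+ 4 = (normc x ^+ 2) ^+ 2 by rewrite -exprM.
rewrite e in h4; have := sqr_ge0 (normc x ^+ 2).
move: h1 h2 h4 h5.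
move: (normc x ^+ 2) (normc v ^+ 2) (normc v ^+ 4) => X V V4.
move: (normc (v + x) ^+ 4) (normc (v - x) ^+ 4) => a b.
move: (normc (v + x) ^+ 2) (normc (v - x) ^+ 2) => a' b'.
lra.
Qed.

(* From [t >= t ^+ 2 - t ^+ 4 / 4] at [t = |S| / sigma]: the second moment of
   S is sigma^2 and the fourth at most 3 sigma^4. *)
Lemma khintchine_lower s :
  Num.sqrt (sqsum s) <= 4 * sign_mean (@normc R) 0 s.
Proof.
set g := Num.sqrt _.
have g0 : 0 <= g by exact: sqrtr_ge0.
have g2 : g ^+ 2 = sqsum s by rewrite sqr_sqrtr// sqsum_ge0.
have m0 : 0 <= sign_mean (@normc R) 0 s by apply: sign_mean_ge0; exact: normc_ge0.
move: g0; rewrite le_eqVlt => /predU1P[<-|g0]; first by rewrite mulr_ge0.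
have key : sign_mean (fun z : R[i] =>
      g ^+ 2 * normc z ^+ 2 + - 4^-1 * normc z ^+ 4) 0 s <=
    g ^+ 3 * sign_mean (@normc R) 0 s.
  rewrite -sign_meanZ; apply: le_sign_mean => z; have := normc_ge0 z.
  move: (normc z) => t t0.
  suff : 0 <= t * (g ^+ 3 - g ^+ 2 * t + t ^+ 3 / 4) by lra.
  apply: mulr_ge0 => //.
  (* The cubic to be bounded has its minimum at t = 2 g / sqrt 3, for which 6/5 is a rational
     substitute; the factor 12/5 cancels the term in t^2. *)
  have h1 : 0 <= (t - 6 / 5 * g) ^+ 2 * (t + 12 / 5 * g).
    by rewrite mulr_ge0 ?sqr_ge0// addr_ge0// mulr_ge0// ltW.
  have h2 : 0 <= g ^+ 2 * t by rewrite mulr_ge0 ?sqr_ge0.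
  have h3 : 0 <= g ^+ 3 by rewrite exprn_ge0// ltW.
  by lra.
rewrite sign_meanD !sign_meanZ sign_mean_normc2 normc0 expr0n/= add0r -g2 in key.
have h4 := sign_mean_normc4 0 s; rewrite normc0 !expr0n/= -g2 in h4.
rewrite -(ler_pM2l (exprn_gt0 3 g0)); move: h4 key; clear g2.
move: (sign_mean _ 0 s) (sign_mean _ 0 s) => M4 m; move: g g0 => g g0.
by lra.
Qed.

(** Sub-Gaussian bound, one sign at a time, from cosh a <= exp (2 a^2) for |a| <= 1/2. *)
Lemma sign_mean_expR (h : R[i] -> R) v s :
  {morph h : a b / a + b} -> {morph h : a b / a - b} ->
  (forall z, z \in s -> `|h z| <= 2^-1) ->
  sign_mean (expR \o h) v s <= expR (h v + 2 * \sum_(z <- s) h z ^+ 2).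
Proof.
move=> hD hB.
elim: s v => [|x s IH] v hs /=; first by rewrite big_nil mulr0 addr0.
have hs' z : z \in s -> `|h z| <= 2^-1 by move=> zs; rewrite hs// inE zs orbT.
(* From exp (-a) >= 1 - a, because (1 - a) (1 + a + 2 a^2) = 1 + a^2 (1 - 2 a) >= 1. *)
have h1 (a : R) : a <= 2^-1 -> expR a <= 1 + a + 2 * a ^+ 2.
  move=> a1; have := expR_ge1Dx (- a); rewrite expRN => a2.
  have e0 := expR_gt0 a; have : (1 - a) * expR a <= 1.
    by rewrite -(ler_pM2r e0) mulVf ?gt_eqF// in a2.
  have : 0 <= a ^+ 2 * (1 - 2 * a) by rewrite mulr_ge0 ?sqr_ge0//; lra.
  have a3 : 0 < 1 - a by lra.
  move=> a4 a5; rewrite -(ler_pM2l a3); apply: le_trans a5 _; lra.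
have cosh (a : R) : `|a| <= 2^-1 -> (expR a + expR (- a)) / 2 <= expR (2 * a ^+ 2).
  rewrite ler_norml => /andP[a1 a2]; apply: le_trans (expR_ge1Dx _).
  have := h1 _ a2; have := h1 (- a); rewrite sqrrN; lra.
apply: le_trans (_ : (expR (h (v + x) + 2 * \sum_(z <- s) h z ^+ 2) +
    expR (h (v - x) + 2 * \sum_(z <- s) h z ^+ 2)) / 2 <= _).
  by rewrite ler_pM2r ?invr_gt0// lerD// IH.
rewrite hD hB big_cons mulrDr !expRD.
have := cosh _ (hs x (mem_head _ _)).
set S := expR (2 * \sum_(_ <- _) _); set E := expR (2 * _ ^+ 2); set A := expR (h x).
set B := expR (- h x); set V := expR (h v) => AB.
have VS0 : 0 <= V * S by rewrite mulr_ge0 ?expR_ge0.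
by have := ler_wpM2l VS0 AB; lra.
Qed.

Lemma powR_le_expR (p t : R) : 1 <= p -> 0 <= t -> t `^ p <= p `^ p * expR t.
Proof.
move=> p1 t0; have p0 : 0 < p by exact: lt_le_trans p1.
have -> : expR t = expR (t / p) `^ p.
  by rewrite -expRM mulrAC -mulrA mulfV ?mulr1// gt_eqF.
have pge := ltW p0; rewrite -powRM ?expR_ge0//; apply: le_powR_base => //.
rewrite mulrC -ler_pdivrMr//; have := expR_ge1Dx (t / p); lra.
Qed.

Lemma normc_le_re_im (z : R[i]) :
  normc z <= `|complex.Re z| + `|complex.Im z|.
Proof.
case: z => a b /=; rewrite -[leRHS]ger0_norm ?addr_ge0// -sqrtr_sqr ler_sqrt ?sqr_ge0//.
rewrite sqrrD !real_normK ?num_real//.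
by have := mulr_ge0 (normr_ge0 a) (normr_ge0 b); lra.
Qed.

Lemma re_im_le_normc (z : R[i]) :
  `|complex.Re z| <= normc z /\ `|complex.Im z| <= normc z.
Proof.
by case: z => a b /=; split; rewrite -sqrtr_sqr ler_sqrt ?addr_ge0 ?sqr_ge0// ?lerDl ?lerDr sqr_ge0.
Qed.

Lemma expR_norm_le (a : R) : expR `|a| <= expR a + expR (- a).
Proof. by case: (ger0P a) => _; rewrite ?lerDl ?lerDr expR_ge0. Qed.

(** The p-th power is dominated by exponentials of the real and imaginary parts, scaled by 1 / (2
    g), whose sign means are at most exp (1/2). *)
Lemma khintchine_upper (p : R) s : 1 <= p ->
  sign_mean (fun z : R[i] => normc z `^ p) 0 s <=
  (4 * p) `^ p * (2 * expR 2^-1) * Num.sqrt (sqsum s) `^ p.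
Proof.
move=> p1; set g := Num.sqrt _.
have p0 : 0 <= p by rewrite (le_trans _ p1).
have g0 : 0 <= g by exact: sqrtr_ge0.
have g2 : g ^+ 2 = sqsum s by rewrite sqr_sqrtr// sqsum_ge0.
have sg z : z \in s -> normc z <= g.
  move=> zs; rewrite -(ler_pXn2r (n := 2)) ?nnegrE ?normc_ge0//.
  rewrite g2 /sqsum (big_rem z)//= lerDl; apply: sumr_ge0 => *; exact: sqr_ge0.
(* If g = 0 all entries of [s] vanish, and the scaling by 1 / (2 g) is meaningless. *)
move: g0; rewrite le_eqVlt => /predU1P[g0|g0].
  suff -> : sign_mean (fun z : R[i] => normc z `^ p) 0 s = 0.
    by rewrite mulr_ge0 ?mulr_ge0 ?powR_ge0 ?expR_ge0.
  have : forall z, z \in s -> z = 0.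
    by move=> z /sg; rewrite -g0 => z0; apply/eq0_normc/eqP; rewrite eq_le z0 normc_ge0.
  elim: (s) => [|x l IH] l0 /=; first
    by rewrite -[LHS]/(normc (0 : R[i]) `^ p) normc0 powR0// gt_eqF// (lt_le_trans ltr01).
  have l0' z : z \in l -> z = 0 by move=> zl; apply: l0; rewrite inE zl orbT.
  by rewrite (l0 x) ?mem_head// subr0 addr0 !(IH l0') addr0 mul0r.
(* The scale makes each |h z| at most 1/2, as [sign_mean_expR] requires, and the exponent at most 2
   g^2 / (2 g)^2 = 1/2. *)
have exp_mean (h : R[i] -> R) : {morph h : a b / a + b} -> {morph h : a b / a - b} ->
    (forall z, `|h z| <= (2 * g)^-1 * normc z) ->
    sign_mean (expR \o h) 0 s <= expR 2^-1.
  move=> hD hB hz; apply: le_trans (@sign_mean_expR h 0 s hD hB _) _.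
    move=> z zs; apply: le_trans (hz z) _; rewrite ler_pdivrMl ?mulr_gt0//.
    by apply: le_trans (sg z zs) _; lra.
  have -> : h 0 = 0 by have := hB 0 0; rewrite !subrr.
  rewrite add0r ler_expR.
  apply: (@le_trans _ _ (2 * \sum_(z <- s) (2 * g) ^- 2 * normc z ^+ 2)).
    rewrite ler_pM2l//; apply: ler_sum => z _.
    rewrite -exprVn -exprMn -real_normK ?num_real//.
    by rewrite ler_pXn2r ?nnegrE// mulr_ge0 ?invr_ge0 ?mulr_ge0 ?normc_ge0// ltW.
  rewrite -mulr_sumr -/(sqsum s) -g2 exprMn invfM -mulrA mulVf ?expf_neq0 ?gt_eqF//.
  by lra.
have reD (c : R) : {morph (fun z : R[i] => c * complex.Re z) : a b / a + b}.
  by move=> [a1 a2] [b1 b2] /=; rewrite mulrDr.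
have reB (c : R) : {morph (fun z : R[i] => c * complex.Re z) : a b / a - b}.
  by move=> [a1 a2] [b1 b2] /=; rewrite mulrBr.
have imD (c : R) : {morph (fun z : R[i] => c * complex.Im z) : a b / a + b}.
  by move=> [a1 a2] [b1 b2] /=; rewrite mulrDr.
have imB (c : R) : {morph (fun z : R[i] => c * complex.Im z) : a b / a - b}.
  by move=> [a1 a2] [b1 b2] /=; rewrite mulrBr.
pose c := (2 * g)^-1.
have c0 : 0 <= c by rewrite invr_ge0 mulr_ge0// ltW.
have bd (z : R[i]) : normc z `^ p <= (4 * p) `^ p * g `^ p * 2^-1 *
   ((expR (c * complex.Re z) + expR (- c * complex.Re z)) +
    (expR (c * complex.Im z) + expR (- c * complex.Im z))).
  pose t := normc z / (4 * g).
  have g40 : 0 < 4 * g by rewrite mulr_gt0.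
  have t0 : 0 <= t by rewrite divr_ge0 ?normc_ge0// ltW.
  have -> : normc z = 4 * g * t by rewrite /t mulrC divfK// gt_eqF.
  rewrite (powRM p (ltW g40) t0).
  apply: le_trans (ler_wpM2l (powR_ge0 _ _) (@powR_le_expR p t p1 t0)) _.
  rewrite (powRM p (ler0n R 4) (ltW g0)) (powRM p (ler0n R 4) p0).
  rewrite [X in _ <= X](_ : _ = 4 `^ p * g `^ p * (p `^ p * (2^-1 *
    ((expR (c * complex.Re z) + expR (- c * complex.Re z)) +
    (expR (c * complex.Im z) + expR (- c * complex.Im z)))))); last by lra.
  rewrite ler_wpM2l ?mulr_ge0 ?powR_ge0// ler_wpM2l ?powR_ge0//.
  have tc : t <= (`|c * complex.Re z| + `|c * complex.Im z|) / 2.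
    rewrite !normrM (ger0_norm c0) -mulrDr.
    have := ler_wpM2l c0 (normc_le_re_im z).
    suff -> : t = c * normc z / 2 by rewrite ler_pM2r ?invr_gt0.
    by rewrite /t /c mulrC -[4](_ : 2 * 2 = _) -?natrM// -mulrA !invfM; lra.
  apply: (@le_trans _ _ (2^-1 * (expR `|c * complex.Re z| + expR `|c * complex.Im z|))).
    apply: le_trans (_ : expR ((`|c * complex.Re z| + `|c * complex.Im z|) / 2) <= _).
      by rewrite ler_expR.
    set a := `|_|; set b := `|_|.
    have -> : expR ((a + b) / 2) = expR (a / 2) * expR (b / 2) by rewrite -expRD mulrDl.
    have -> : expR a = expR (a / 2) ^+ 2 by rewrite -expRM_natl; congr expR; lra.
    have -> : expR b = expR (b / 2) ^+ 2 by rewrite -expRM_natl; congr expR; lra.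
    (* The arithmetic-geometric mean inequality for exp a and exp b. *)
    have := sqr_ge0 (expR (a / 2) - expR (b / 2)); lra.
  rewrite ler_pM2l ?invr_gt0// !mulNr lerD ?expR_norm_le//.
apply: le_trans (@le_sign_mean _ _ _ _ 0 s bd) _; rewrite sign_meanZ !sign_meanD.
have cn : `|- c| = c by rewrite normrN ger0_norm.
have cp : `|c| = c by rewrite ger0_norm.
have m1 : sign_mean (fun z : R[i] => expR (c * complex.Re z)) 0 s <= expR 2^-1.
  by apply: exp_mean => // z; rewrite normrM cp ler_wpM2l// (re_im_le_normc z).1.
have m2 : sign_mean (fun z : R[i] => expR (- c * complex.Re z)) 0 s <= expR 2^-1.
  by apply: exp_mean => // z; rewrite normrM cn ler_wpM2l// (re_im_le_normc z).1.
have m3 : sign_mean (fun z : R[i] => expR (c * complex.Im z)) 0 s <= expR 2^-1.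
  by apply: exp_mean => // z; rewrite normrM cp ler_wpM2l// (re_im_le_normc z).2.
have m4 : sign_mean (fun z : R[i] => expR (- c * complex.Im z)) 0 s <= expR 2^-1.
  by apply: exp_mean => // z; rewrite normrM cn ler_wpM2l// (re_im_le_normc z).2.
have h := lerD (lerD m1 m2) (lerD m3 m4).
have A0 : 0 <= (4 * p) `^ p * g `^ p * 2^-1 by rewrite !mulr_ge0 ?powR_ge0.
apply: le_trans (ler_wpM2l A0 h) _; rewrite le_eqVlt; apply/orP; left; apply/eqP.
by lra.
Qed.

End Khintchine.

(** * Powers of integrals *)

Section PowerInequalities.
Context {R : realType}.
Implicit Types q a b : R.

Lemma powRD_sup q a b : 1 <= q -> 0 <= a -> 0 <= b ->
  a `^ q + b `^ q <= (a + b) `^ q.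
Proof.
move=> q1 a0 b0; have q0 : 0 < q by exact: lt_le_trans q1.
have ab0 : 0 <= a + b by rewrite addr_ge0.
rewrite -(mulr_powRB1 a0 q0) -(mulr_powRB1 b0 q0) -(mulr_powRB1 ab0 q0) mulrDl.
by rewrite lerD// ler_wpM2l// le_powR_base ?subr_ge0// ?lerDl ?lerDr.
Qed.

(** Superadditivity for the exponent 1/q, applied to a^q and b^q. *)
Lemma powRD_sub q a b : 0 < q -> q <= 1 -> 0 <= a -> 0 <= b ->
  (a + b) `^ q <= a `^ q + b `^ q.
Proof.
move=> q0 q1 a0 b0; have qi : 1 <= q^-1 by rewrite invf_ge1.
have := @powRD_sup _ _ _ qi (powR_ge0 a q) (powR_ge0 b q).
rewrite !powRK ?gt_eqF// => h; apply: (@powR_base_le _ _ _ q^-1).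
- by rewrite invr_gt0.
- by rewrite addr_ge0 ?powR_ge0.
- by rewrite powRK ?addr_ge0 ?gt_eqF.
Qed.

Lemma powR_concave (q x y a b : R) : 0 < q -> q <= 1 -> 0 <= x -> x <= 1 ->
  y = 1 - x -> 0 <= a -> 0 <= b ->
  x * a `^ q + y * b `^ q <= (x * a + y * b) `^ q.
Proof.
move=> q0 q1 x0 x1 yE a0 b0; have qi : 1 <= q^-1 by rewrite invf_ge1.
have y0 : 0 <= y by rewrite yE subr_ge0.
have := @powR_convex _ _ _ _ _ _ qi x0 x1 yE (powR_ge0 a q) (powR_ge0 b q).
rewrite !powRK ?gt_eqF// => h; apply: (@powR_base_le _ _ _ q^-1).
- by rewrite invr_gt0.
- exact: powR_ge0.
- by rewrite [leRHS]powRK ?addr_ge0 ?mulr_ge0 ?gt_eqF.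
Qed.

End PowerInequalities.

Section PowerIntegral.
Context {d : measure_display} {Omega : measurableType d} {R : realType}.
Variable mu : {measure set Omega -> \bar R}.
Implicit Types (f g : Omega -> R) (q : R).

(** [fine] sends an infinite integral to 0, so this is paired with [powR_integrable]. *)
Definition powR_integral q f : R := fine (\int[mu]_t (f t `^ q)%:E)%E.

Definition powR_integrable q f :=
  [/\ measurable_fun setT f, forall t, 0 <= f t &
      (\int[mu]_t (f t `^ q)%:E < +oo)%E].

Lemma measurable_powR_EFin q f : measurable_fun setT f ->
  measurable_fun setT (fun t => (f t `^ q)%:E).
Proof.
by move=> mf; apply/measurable_EFinP/(@measurableT_comp _ _ _ _ _ _ (@powR R ^~ q)).
Qed.

Lemma powR_integralE q f : powR_integrable q f ->
  (powR_integral q f)%:E = (\int[mu]_t (f t `^ q)%:E)%E.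
Proof.
case=> _ _ h; rewrite fineK// ge0_fin_numE// integral_ge0// => t _.
by rewrite lee_fin powR_ge0.
Qed.

Lemma powR_integral_ge0 q f : 0 <= powR_integral q f.
Proof. by apply: fine_ge0; apply: integral_ge0 => t _; rewrite lee_fin powR_ge0. Qed.

Lemma powR_integral_le q r f c g : 0 <= c ->
  measurable_fun setT f -> (forall t, 0 <= f t) -> powR_integrable r g ->
  (forall t, f t `^ q <= c * g t `^ r) ->
  powR_integrable q f /\ powR_integral q f <= c * powR_integral r g.
Proof.
move=> c0 mf f0 ig fg; have [mg g0 fing] := ig.
have le : (\int[mu]_t (f t `^ q)%:E <= (c * powR_integral r g)%:E)%E.
  rewrite EFinM (powR_integralE r g ig) -ge0_integralZl_EFin//; last 2 first.
  - by move=> t _; rewrite lee_fin powR_ge0.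
  - exact: measurable_powR_EFin.
  apply: ge0_le_integral => //.
  - by move=> t _; rewrite lee_fin powR_ge0.
  - exact: measurable_powR_EFin.
  - by apply: measurable_funeM; exact: measurable_powR_EFin.
  - by move=> t _; rewrite -EFinM lee_fin.
have iF : powR_integrable q f.
  by split; [exact: mf|exact: f0|exact: le_lt_trans le (ltry _)].
by split=> //; rewrite -lee_fin powR_integralE.
Qed.

Lemma powR_integral_sum q f g : powR_integrable q f -> powR_integrable q g ->
  (\int[mu]_t (f t `^ q + g t `^ q)%:E)%E =
  (powR_integral q f + powR_integral q g)%:E.
Proof.
move=> hf hg; rewrite [RHS]EFinD !powR_integralE//.
rewrite -ge0_integralD//.
- by move=> t _; rewrite lee_fin powR_ge0.
- by case: hf => mf _ _; exact: measurable_powR_EFin.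
- by move=> t _; rewrite lee_fin powR_ge0.
- by case: hg => mg _ _; exact: measurable_powR_EFin.
Qed.

Lemma powR_integralZ q c f : 0 <= c -> powR_integrable q f ->
  powR_integrable q (fun t => c * f t) /\
  powR_integral q (fun t => c * f t) = c `^ q * powR_integral q f.
Proof.
move=> c0 hf; have [mf f0 finf] := hf.
have e : (\int[mu]_t ((c * f t) `^ q)%:E = (c `^ q * powR_integral q f)%:E)%E.
  rewrite EFinM powR_integralE// -ge0_integralZl_EFin ?powR_ge0//; last 2 first.
  - by move=> t _; rewrite lee_fin powR_ge0.
  - exact: measurable_powR_EFin.
  by apply: eq_integral => t _; rewrite powRM// EFinM.
split; last by rewrite /powR_integral e.
split; last by rewrite e ltry.
- exact: measurable_funM.
- by move=> t; rewrite mulr_ge0.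
Qed.

(** From f + g <= 2 max(f, g), an argument that also covers exponents below 1. *)
Lemma powR_integrableD q f g : 0 <= q ->
  powR_integrable q f -> powR_integrable q g ->
  powR_integrable q (fun t => f t + g t).
Proof.
move=> q0 hf hg; have [mf f0 finf] := hf; have [mg g0 fing] := hg.
split; first exact: measurable_funD.
  by move=> t; rewrite addr_ge0.
apply: le_lt_trans (ltry (2 `^ q * (powR_integral q f + powR_integral q g))).
rewrite EFinM -powR_integral_sum// -ge0_integralZl_EFin ?powR_ge0//; last 2 first.
- by move=> t _; rewrite lee_fin addr_ge0 ?powR_ge0.
- by under eq_fun do rewrite EFinD; apply: emeasurable_funD; exact: measurable_powR_EFin.
apply: ge0_le_integral => //.
- by move=> t _; rewrite lee_fin powR_ge0.
- by apply: measurable_powR_EFin; exact: measurable_funD.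
- apply: measurable_funeM; under eq_fun do rewrite EFinD.
  by apply: emeasurable_funD; exact: measurable_powR_EFin.
move=> t _; rewrite -EFinM lee_fin.
apply: (@le_trans _ _ ((2 * Num.max (f t) (g t)) `^ q)).
  apply: le_powR_base; rewrite ?addr_ge0// mulr_natl mulr2n.
  by rewrite lerD// le_max lexx ?orbT.
rewrite powRM// ?le_max ?f0// ler_wpM2l ?powR_ge0//.
by case: (leP (f t) (g t)) => _; rewrite ?lerDl ?lerDr powR_ge0.
Qed.

Lemma powR_integralD_sub q f g : 0 < q -> q <= 1 ->
  powR_integrable q f -> powR_integrable q g ->
  powR_integral q (fun t => f t + g t) <= powR_integral q f + powR_integral q g.
Proof.
move=> q0 q1 hf hg; have [mf f0 finf] := hf; have [mg g0 fing] := hg.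
have hfg := @powR_integrableD q f g (ltW q0) hf hg; have [mfg _ _] := hfg.
rewrite -lee_fin powR_integralE// -powR_integral_sum//.
apply: ge0_le_integral => //.
- by move=> t _; rewrite lee_fin powR_ge0.
- exact: measurable_powR_EFin.
- under eq_fun do rewrite EFinD.
  by apply: emeasurable_funD; exact: measurable_powR_EFin.
- by move=> t _; rewrite lee_fin powRD_sub.
Qed.

Lemma powR_integral_add_le q f g h :
  powR_integrable q f -> powR_integrable q g -> powR_integrable q h ->
  (forall t, f t `^ q + g t `^ q <= h t `^ q) ->
  powR_integral q f + powR_integral q g <= powR_integral q h.
Proof.
move=> hf hg hh fgh; have [mf f0 _] := hf; have [mg g0 _] := hg.
have [mh h0 _] := hh.
rewrite -lee_fin -powR_integral_sum// powR_integralE//.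
apply: ge0_le_integral => //.
- by move=> t _; rewrite lee_fin addr_ge0 ?powR_ge0.
- under eq_fun do rewrite EFinD.
  by apply: emeasurable_funD; exact: measurable_powR_EFin.
- exact: measurable_powR_EFin.
- by move=> t _; rewrite lee_fin.
Qed.

Lemma powR_integralD_sup q f g : 1 <= q ->
  powR_integrable q f -> powR_integrable q g ->
  powR_integral q f + powR_integral q g <= powR_integral q (fun t => f t + g t).
Proof.
move=> q1 hf hg; have [_ f0 _] := hf; have [_ g0 _] := hg.
apply: (powR_integral_add_le _ _ _ _ hf hg
  (powR_integrableD _ _ _ (le_trans ler01 q1) hf hg)) => t.
exact: powRD_sup.
Qed.

Lemma Lnorm_powR_integral q f : 0 < q -> powR_integrable q f ->
  Lnorm mu q%:E (EFin \o f) = (powR_integral q f `^ q^-1)%:E.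
Proof.
move=> q0 hf; have [_ f0 _] := hf.
rewrite unlock -poweR_EFin; congr (_ `^ _)%E; rewrite (powR_integralE _ _ hf).
by apply: eq_integral => t _ /=; rewrite ger0_norm.
Qed.

Lemma powR_integral_minkowski q f g : 1 <= q ->
  powR_integrable q f -> powR_integrable q g ->
  powR_integral q (fun t => f t + g t) `^ q^-1 <=
  powR_integral q f `^ q^-1 + powR_integral q g `^ q^-1.
Proof.
move=> q1 hf hg; have q0 : 0 < q by exact: lt_le_trans q1.
have hfg := @powR_integrableD q f g (ltW q0) hf hg.
have [mf _ _] := hf; have [mg _ _] := hg.
have := minkowski_EFin mu mf mg q1.
have -> : Lnorm mu q%:E (EFin \o (f \+ g)) =
  (powR_integral q (fun t => f t + g t) `^ q^-1)%:E by exact: Lnorm_powR_integral.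
by rewrite (Lnorm_powR_integral _ _ q0 hf) (Lnorm_powR_integral _ _ q0 hg) lee_fin.
Qed.

Lemma powR_integral_le_sum q f g : 0 < q ->
  powR_integrable q f -> powR_integrable q g ->
  powR_integral q f <= powR_integral q (fun t => f t + g t).
Proof.
move=> q0 hf hg; have [mf f0 _] := hf; have [mg g0 _] := hg.
have h t : f t `^ q <= 1 * (f t + g t) `^ q.
  by rewrite mul1r le_powR_base ?lerDl// ltW.
have [_] := @powR_integral_le q q f 1 (fun t => f t + g t) ler01 mf f0
  (powR_integrableD _ _ _ (ltW q0) hf hg) h.
by rewrite mul1r.
Qed.

(* Normalise f and g by their quasi-norms a and b and use concavity of
   u |-> u `^ q at the convex combination with weights a / (a + b) and
   b / (a + b). *)
Lemma powR_le_integralD q f g (a b : R) : 0 < q -> q <= 1 ->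
  powR_integrable q f -> powR_integrable q g -> 0 <= a -> 0 <= b ->
  powR_integral q f = a `^ q -> powR_integral q g = b `^ q ->
  (a + b) `^ q <= powR_integral q (fun t => f t + g t).
Proof.
move=> q0 q1 hf hg a0 b0 If Ig.
have [mf f0 _] := hf; have [mg g0 _] := hg.
move: a0; rewrite le_eqVlt => /predU1P[a0|a0].
  rewrite -a0 add0r -Ig; under [X in _ <= powR_integral q X]eq_fun do rewrite addrC.
  exact: powR_integral_le_sum.
move: b0; rewrite le_eqVlt => /predU1P[b0|b0].
  by rewrite -b0 addr0 -If; exact: powR_integral_le_sum.
have ab0 : 0 < a + b by rewrite addr_gt0.
pose x := a / (a + b); pose y := b / (a + b).
have x0 : 0 <= x by rewrite divr_ge0 ?ltW.
have y0 : 0 <= y by rewrite divr_ge0 ?ltW.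
have yE : y = 1 - x by rewrite /y /x -[1](mulfV (lt0r_neq0 ab0)) -mulrBl addrAC subrr add0r.
have x1 : x <= 1 by rewrite -subr_ge0 -yE.
have xa : x * (a + b) = a by rewrite divfK ?gt_eqF.
have yb : y * (a + b) = b by rewrite divfK ?gt_eqF.
clearbody x y.
have sa : 0 <= (a + b) / a by rewrite divr_ge0 ?ltW.
have sb : 0 <= (a + b) / b by rewrite divr_ge0 ?ltW.
have qn0 : q != 0 by rewrite gt_eqF.
(* Chosen so that (u f)^q is x times the q-th power of (a + b) f / a. The convex combination of the
   rescaled functions is then f + g, while the integrals add up to (x + y) (a + b)^q. *)
pose u := x `^ q^-1 * ((a + b) / a); pose v := y `^ q^-1 * ((a + b) / b).
have u0 : 0 <= u by rewrite mulr_ge0 ?powR_ge0.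
have v0 : 0 <= v by rewrite mulr_ge0 ?powR_ge0.
have uE : u `^ q = x * ((a + b) / a) `^ q.
  by rewrite (powRM q (powR_ge0 _ _) sa) (powR_invK _ _ x0 qn0).
have vE : v `^ q = y * ((a + b) / b) `^ q.
  by rewrite (powRM q (powR_ge0 _ _) sb) (powR_invK _ _ y0 qn0).
have [hf' If'] := powR_integralZ q u f u0 hf.
have [hg' Ig'] := powR_integralZ q v g v0 hg.
have pw t : (u * f t) `^ q + (v * g t) `^ q <= (f t + g t) `^ q.
  rewrite (powRM q u0 (f0 t)) (powRM q v0 (g0 t)) uE vE -!mulrA.
  rewrite -(powRM q sa (f0 t)) -(powRM q sb (g0 t)).
  apply: le_trans (@powR_concave _ q x y _ _ q0 q1 x0 x1 yE
    (mulr_ge0 sa (f0 t)) (mulr_ge0 sb (g0 t))) _.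
  rewrite !mulrA; suff [-> ->] : x * (a + b) / a = 1 /\ y * (a + b) / b = 1.
    by rewrite !mul1r.
  by rewrite xa yb !mulfV ?gt_eqF.
have := @powR_integral_add_le q _ _ _ hf' hg' (powR_integrableD _ _ _ (ltW q0) hf hg) pw.
apply: le_trans; rewrite If' Ig' If Ig uE vE -!mulrA.
rewrite -(powRM q sa (ltW a0)) -(powRM q sb (ltW b0)) !divfK ?gt_eqF//.
by rewrite -mulrDl yE subrKC mul1r.
Qed.

Lemma powR_integral_reverse_minkowski q f g : 0 < q -> q <= 1 ->
  powR_integrable q f -> powR_integrable q g ->
  powR_integral q f `^ q^-1 + powR_integral q g `^ q^-1 <=
  powR_integral q (fun t => f t + g t) `^ q^-1.
Proof.
move=> q0 q1 hf hg; have qn0 : q != 0 by rewrite gt_eqF.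
apply: (@powR_base_le _ _ _ q q0 (powR_ge0 _ _)).
rewrite (powR_invK _ _ (powR_integral_ge0 q (fun t => f t + g t)) qn0).
apply: (@powR_le_integralD q f g _ _ q0 q1 hf hg (powR_ge0 _ _) (powR_ge0 _ _)).
- exact/esym/(powR_invK _ _ (powR_integral_ge0 q f) qn0).
- exact/esym/(powR_invK _ _ (powR_integral_ge0 q g) qn0).
Qed.

End PowerIntegral.

(** * Square functions in L^p *)

Section SquareFunction.
Context {d : measure_display} {Omega : measurableType d} {R : realType}.
Context {mu : {measure set Omega -> \bar R}} {p : R} {p1 : 1 <= p}.

Notation Lfun := (complex_LfunType mu p1).
Notation X := (complex_Lspace mu p1).
Implicit Types (f : Lfun) (l : seq Lfun) (s : seq X).

Let p0 : 0 < p. Proof. exact: lt_le_trans p1. Qed.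
Let q0 : 0 < p / 2. Proof. by rewrite divr_gt0. Qed.

Lemma powR_half_sqr (a : R) : 0 <= a -> (a ^+ 2) `^ (p / 2) = a `^ p.
Proof.
move=> a0; rewrite -powR_mulrn// -powRrM; congr (_ `^ _).
by rewrite mulrC divfK.
Qed.

Lemma sqrt_powR (a : R) : 0 <= a -> Num.sqrt a `^ p = a `^ (p / 2).
Proof. by move=> a0; rewrite -powR_half_sqr ?sqrtr_ge0// sqr_sqrtr. Qed.

Lemma Lfun_powR_integrable f : powR_integrable mu p (fun t => normc (f t)).
Proof.
have [mf finf] := complex_LfunP f; split; first exact: measurable_normc.
  by move=> t; exact: normc_ge0.
have /(congr1 (fun z => (z < +oo)%E)) := @powR_Lnorm _ _ _ mu
  (fun t => (normc (f t))%:E) p (lt0r_neq0 p0).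
rewrite (_ : (_ < _)%E = true); last by apply: poweR_lty.
move=> /esym; apply: le_lt_trans; rewrite le_eqVlt; apply/orP; left; apply/eqP.
by apply: eq_integral => t _ /=; rewrite ger0_norm ?normc_ge0.
Qed.

Lemma norm_pi f : `|\pi_X f| = powR_integral mu p (fun t => normc (f t)) `^ p^-1.
Proof.
rewrite -[LHS]/(complex_Lspace_norm (\pi_X f)) complex_Lspace_norm_pi.
by rewrite /complex_Lnorm (Lnorm_powR_integral _ _ _ p0 (Lfun_powR_integrable f)).
Qed.

Definition square_sum l t : R := sqsum [seq (f : Omega -> R[i]) t | f <- l].

Lemma square_sum_cons f l :
  square_sum (f :: l) = (fun t => normc (f t) ^+ 2 + square_sum l t).
Proof. by apply/funext => t; exact: sqsum_cons. Qed.

Lemma square_sum_cat l1 l2 :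
  square_sum (l1 ++ l2) = (fun t => square_sum l1 t + square_sum l2 t).
Proof. by apply/funext => t; rewrite /square_sum map_cat /sqsum big_cat. Qed.

Lemma normc2_integrable f :
  powR_integrable mu (p / 2) (fun t => normc (f t) ^+ 2).
Proof.
have [mf _ h] := Lfun_powR_integrable f; split; first exact: measurable_funX.
  by move=> t; exact: sqr_ge0.
by under eq_integral do rewrite powR_half_sqr ?normc_ge0//.
Qed.

Lemma square_sum_integrable l : powR_integrable mu (p / 2) (square_sum l).
Proof.
elim: l => [|f l IH].
  rewrite (_ : square_sum [::] = fun=> 0); last first.
    by apply/funext => t; rewrite /square_sum /sqsum big_nil.
  split => //; rewrite powR0 ?gt_eqF//.
  by rewrite integral0.
rewrite square_sum_cons.
exact: (powR_integrableD _ _ _ _ (ltW q0) (normc2_integrable f) IH).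
Qed.

(** The L^p norm of (\sum |x_i|^2)^(1/2), computed on chosen representatives and written through the
    exponent p/2 so that no square root occurs. *)
Definition square_norm s : R :=
  powR_integral mu (p / 2) (square_sum (map repr s)) `^ p^-1.

Lemma square_norm_ge0 s : 0 <= square_norm s.
Proof. exact: powR_ge0. Qed.

Lemma square_norm_nil : square_norm [::] = 0.
Proof.
rewrite /square_norm /powR_integral (_ : square_sum _ = fun=> 0); last first.
  by apply/funext => t; rewrite /square_sum /sqsum big_nil.
by rewrite powR0 ?gt_eqF// integral0 /= powR0// invr_neq0 ?gt_eqF.
Qed.

Lemma square_norm1 (x : X) : square_norm [:: x] = `|x|.
Proof.
rewrite -[x in RHS]reprK norm_pi /square_norm.
suff -> : powR_integral mu (p / 2) (square_sum (map repr [:: x])) =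
  powR_integral mu p (fun t => normc (repr x t)) by [].
rewrite /powR_integral; congr fine; apply: eq_integral => t _.
by rewrite square_sum_cons /square_sum /sqsum big_nil addr0 powR_half_sqr ?normc_ge0.
Qed.

Lemma square_norm_perm s1 s2 : perm_eq s1 s2 -> square_norm s1 = square_norm s2.
Proof.
move=> s12; suff e : square_sum (map repr s1) = square_sum (map repr s2).
  by rewrite /square_norm e.
by apply/funext => t; rewrite /square_sum /sqsum !big_map; exact: perm_big.
Qed.

Lemma powR_invK_le_add (a b c : R) : 0 <= a -> 0 <= b -> 0 <= c ->
  a <= b + c -> (a `^ p^-1) `^ p <= (b `^ p^-1) `^ p + (c `^ p^-1) `^ p.
Proof. by move=> a0 b0 c0; rewrite !powR_invK ?gt_eqF. Qed.

Lemma powR_invK_add_le (a b c : R) : 0 <= a -> 0 <= b -> 0 <= c ->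
  b + c <= a -> (b `^ p^-1) `^ p + (c `^ p^-1) `^ p <= (a `^ p^-1) `^ p.
Proof. by move=> a0 b0 c0; rewrite !powR_invK ?gt_eqF. Qed.

Lemma powR_inv2_le_add (a b c : R) :
  a `^ (p / 2)^-1 <= b `^ (p / 2)^-1 + c `^ (p / 2)^-1 ->
  (a `^ p^-1) `^ 2 <= (b `^ p^-1) `^ 2 + (c `^ p^-1) `^ 2.
Proof. by rewrite invf_div mulrC !powRrM. Qed.

Lemma powR_inv2_add_le (a b c : R) :
  b `^ (p / 2)^-1 + c `^ (p / 2)^-1 <= a `^ (p / 2)^-1 ->
  (b `^ p^-1) `^ 2 + (c `^ p^-1) `^ 2 <= (a `^ p^-1) `^ 2.
Proof. by rewrite invf_div mulrC !powRrM. Qed.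

(* With g = \sum |f|^2, [square_norm] is the square root of the L^(p/2)
   (quasi-)norm of g, so both estimates below say that this quasi-norm, or its
   power p/2, is sub- or superadditive on nonnegative functions. *)
Lemma square_norm_cat_sub s1 s2 :
  square_norm (s1 ++ s2) `^ Num.min p 2 <=
  square_norm s1 `^ Num.min p 2 + square_norm s2 `^ Num.min p 2.
Proof.
rewrite /square_norm map_cat square_sum_cat.
have h1 := square_sum_integrable (map repr s1).
have h2 := square_sum_integrable (map repr s2).
have [p2|p2] := leP p 2.
  have q1 : p / 2 <= 1 by rewrite ler_pdivrMr// mul1r.
  have := powR_integralD_sub _ _ _ _ q0 q1 h1 h2.
  by apply: powR_invK_le_add; exact: powR_integral_ge0.
have q1 : 1 <= p / 2 by rewrite ler_pdivlMr// mul1r ltW.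
by apply: powR_inv2_le_add; exact: (powR_integral_minkowski _ _ _ _ q1 h1 h2).
Qed.

Lemma square_norm_cat_sup s1 s2 :
  square_norm s1 `^ Num.max p 2 + square_norm s2 `^ Num.max p 2 <=
  square_norm (s1 ++ s2) `^ Num.max p 2.
Proof.
rewrite /square_norm map_cat square_sum_cat.
have h1 := square_sum_integrable (map repr s1).
have h2 := square_sum_integrable (map repr s2).
have [p2|p2] := leP p 2.
  have q1 : p / 2 <= 1 by rewrite ler_pdivrMr// mul1r.
  apply: powR_inv2_add_le.
  exact: (powR_integral_reverse_minkowski _ _ _ _ q0 q1 h1 h2).
have q1 : 1 <= p / 2 by rewrite ler_pdivlMr// mul1r ltW.
have := powR_integralD_sup _ _ _ _ q1 h1 h2.
by apply: powR_invK_add_le; exact: powR_integral_ge0.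
Qed.

Lemma pi_LspaceD : {morph (fun f : Lfun => \pi_X f) : f g / f + g}.
Proof. by move=> f g; rewrite pi_complex_LspaceD. Qed.

Lemma pi_LspaceB : {morph (fun f : Lfun => \pi_X f) : f g / f - g}.
Proof. by move=> f g; rewrite !piE. Qed.

(** The representative of a signed sum agrees with the signed sum of representatives only almost
    everywhere, so the signs are moved to functions before any pointwise evaluation. *)
Lemma sign_mean_pi (phi : X -> R) s :
  sign_mean phi 0 s = sign_mean (fun f : Lfun => phi (\pi_X f)) 0 (map repr s).
Proof.
rewrite -(@sign_mean_map _ _ _ (fun f : Lfun => \pi_X f) phi 0 _ pi_LspaceD pi_LspaceB).
rewrite -map_comp (eq_map (g := id)) ?map_id; last by move=> x /=; rewrite reprK.
by congr sign_mean; rewrite !piE.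
Qed.

Let ev l t : seq R[i] := [seq (f : Omega -> R[i]) t | f <- l].

Lemma measurable_sign_mean (phi : R[i] -> R) f l :
  (forall f : Lfun, measurable_fun setT (fun t => phi (f t))) ->
  measurable_fun setT (fun t => sign_mean phi (f t) (ev l t)).
Proof.
move=> mphi; elim: l f => [|g l IH] f; first exact: mphi.
have hA := IH (f + g); have hB := IH (f - g).
by apply: measurable_funM => //; exact: (measurable_funD hA hB).
Qed.

Lemma measurable_normc_powR f : measurable_fun setT (fun t => normc (f t) `^ p).
Proof.
have [mf _ _] := Lfun_powR_integrable f.
exact: (@measurableT_comp _ _ _ _ _ _ (@powR R ^~ p)).
Qed.

Lemma integral_sign_mean f l :
  (\int[mu]_t (sign_mean (fun z => normc z `^ p) (f t) (ev l t))%:E)%E =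
  (sign_mean (fun g : Lfun => powR_integral mu p (fun t => normc (g t))) f l)%:E.
Proof.
elim: l f => [|g l IH] f.
  by rewrite [RHS](powR_integralE _ _ _ (Lfun_powR_integrable f)).
rewrite [RHS]EFinM [X in _ = (X * _)%E]EFinD -(IH (f + g)) -(IH (f - g)).
have pos (h : Lfun) t : setT t ->
    (0 <= (sign_mean (fun z : R[i] => normc z `^ p) (h t) (ev l t))%:E)%E.
  by move=> _; rewrite lee_fin; apply: sign_mean_ge0 => z; exact: powR_ge0.
have meas (h : Lfun) : measurable_fun setT (fun t =>
    (sign_mean (fun z : R[i] => normc z `^ p) (h t) (ev l t))%:E).
  by apply/measurable_EFinP/measurable_sign_mean; exact: measurable_normc_powR.
rewrite -ge0_integralD//; last 2 first.
- exact: pos.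
- exact: pos.
rewrite muleC -ge0_integralZl_EFin//; last 2 first.
- by move=> t _; rewrite adde_ge0// pos.
- by apply: emeasurable_funD; exact: meas.
by apply: eq_integral => t _; rewrite -EFinD -EFinM mulrC.
Qed.

Definition khintchine_const : R := (4 * p) `^ p * (2 * expR 2^-1).

Lemma khintchine_const_ge0 : 0 <= khintchine_const.
Proof. by rewrite mulr_ge0 ?powR_ge0// mulr_ge0 ?expR_ge0. Qed.

Lemma sign_mean_powR_integral_le l :
  sign_mean (fun g : Lfun => powR_integral mu p (fun t => normc (g t))) 0 l <=
  khintchine_const * powR_integral mu (p / 2) (square_sum l).
Proof.
have hsq := square_sum_integrable l; have [msq sq0 _] := hsq.
rewrite -lee_fin -integral_sign_mean EFinM (powR_integralE _ _ _ hsq).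
rewrite -ge0_integralZl_EFin ?khintchine_const_ge0//; last 2 first.
- by move=> t _; rewrite lee_fin powR_ge0.
- exact: measurable_powR_EFin.
apply: ge0_le_integral => //.
- by move=> t _; rewrite lee_fin; apply: sign_mean_ge0 => z; exact: powR_ge0.
- by apply/measurable_EFinP/measurable_sign_mean; exact: measurable_normc_powR.
- by apply: measurable_funeM; exact: measurable_powR_EFin.
move=> t _; rewrite -EFinM lee_fin -sqrt_powR//.
exact: khintchine_upper.
Qed.

(** Jensen's inequality followed by the pointwise upper Khintchine inequality, integrated. *)
Lemma sign_mean_norm_le s : sign_mean (fun x : X => `|x|) 0 s <=
  khintchine_const `^ p^-1 * square_norm s.
Proof.
apply: (@powR_base_le _ _ _ p) => //.
  by rewrite mulr_ge0 ?powR_ge0// square_norm_ge0.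
rewrite (powRM p (powR_ge0 _ _) (square_norm_ge0 s)).
rewrite (powR_invK _ _ khintchine_const_ge0 (lt0r_neq0 p0)).
rewrite /square_norm (powR_invK _ _ (powR_integral_ge0 _ _ _) (lt0r_neq0 p0)).
apply: le_trans (sign_mean_powR_integral_le (map repr s)).
apply: le_trans (@sign_mean_powR _ _ p (fun x : X => `|x|) 0 s p1 _) _.
  by move=> x; exact: normr_ge0.
rewrite sign_mean_pi; apply: le_sign_mean => f; rewrite norm_pi.
by rewrite (powR_invK _ _ (powR_integral_ge0 _ _ _) (lt0r_neq0 p0)).
Qed.

(** Minkowski's inequality, one sign at a time: the norm of a mean is at most the mean of the
    norms. *)
Lemma powR_integral_sign_mean f l (h := fun t => sign_mean (@normc R) (f t) (ev l t)) :
  powR_integrable mu p h /\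
  powR_integral mu p h `^ p^-1 <= sign_mean (fun g : Lfun => `|\pi_X g|) f l.
Proof.
rewrite {}/h; elim: l f => [|g l IH] f.
  by split; [exact: Lfun_powR_integrable|rewrite /= norm_pi].
have [hA A] := IH (f + g); have [hB B] := IH (f - g).
have half0 : 0 <= 2^-1 :> R by rewrite invr_ge0.
have [iA eA] := powR_integralZ _ _ _ _ half0 hA.
have [iB eB] := powR_integralZ _ _ _ _ half0 hB.
have hE : (fun t => sign_mean (@normc R) (f t) (ev (g :: l) t)) =
    (fun t => 2^-1 * sign_mean (@normc R) ((f + g) t) (ev l t) +
      2^-1 * sign_mean (@normc R) ((f - g) t) (ev l t)).
  by apply/funext => t; rewrite -mulrDr mulrC.
rewrite hE; split; first exact: (powR_integrableD _ _ _ _ (ltW p0) iA iB).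
apply: le_trans (powR_integral_minkowski _ _ _ _ p1 iA iB) _.
rewrite eA eB.
have Z (a : R) : 0 <= a -> (2^-1 `^ p * a) `^ p^-1 = 2^-1 * a `^ p^-1.
  by move=> a0; rewrite (powRM _ (powR_ge0 _ _) a0) (powRK _ _ half0 (lt0r_neq0 p0)).
rewrite (Z _ (powR_integral_ge0 _ _ _)) (Z _ (powR_integral_ge0 _ _ _)).
by rewrite -mulrDr /= mulrC ler_pM2r ?invr_gt0// lerD.
Qed.

Lemma square_norm_le_sign_mean s :
  square_norm s <= 4 * sign_mean (fun x : X => `|x|) 0 s.
Proof.
have [hint hle] := powR_integral_sign_mean 0 (map repr s).
have [msq sq0 _] := square_sum_integrable (map repr s).
have pw t : square_sum (map repr s) t `^ (p / 2) <= 4 `^ p *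
    sign_mean (@normc R) ((0 : Lfun) t) (ev (map repr s) t) `^ p.
  rewrite -sqrt_powR// -powRM//; last first.
    by apply: sign_mean_ge0; exact: normc_ge0.
  apply: le_powR_base; [exact: ltW|exact: sqrtr_ge0|exact: khintchine_lower].
have [_ h] := powR_integral_le _ _ _ _ _ _ (powR_ge0 4 p) msq sq0 hint pw.
rewrite sign_mean_pi; apply: le_trans (ler_wpM2l (ler0n _ 4) hle).
have Z (a : R) : 0 <= a -> (4 `^ p * a) `^ p^-1 = 4 * a `^ p^-1.
  by move=> a0; rewrite (powRM _ (powR_ge0 _ _) a0) (powRK _ _ (ler0n R 4) (lt0r_neq0 p0)).
rewrite -(Z _ (powR_integral_ge0 _ _ _)).
apply: le_powR_base h; [by rewrite invr_ge0 ltW|exact: powR_integral_ge0].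
Qed.

End SquareFunction.

(** * From the Cesaro bound to square functions, and the conclusion *)

Section CesaroBounded.
Context {d : measure_display} {Omega : measurableType d} {R : realType}.
Context {mu : {measure set Omega -> \bar R}} {p : R} {p1 : 1 <= p}.
Notation X := (complex_Lspace mu p1).
Variable T : {linear X -> X}.

Lemma iter_linearD k : {morph iter k T : x y / x + y}.
Proof. by move=> x y; elim: k => //= k ->; rewrite linearD. Qed.

Lemma iter_linearB k : {morph iter k T : x y / x - y}.
Proof. by move=> x y; elim: k => //= k ->; rewrite linearB. Qed.

Lemma iter_linear0 k : iter k T 0 = 0.
Proof. by have := iter_linearB k 0 0; rewrite !subrr. Qed.

Lemma absolutely_Cesaro_bounded_sum (C : R) :
  (forall x, (ereal_sup [set (n%:R^-1 * \sum_(k < n) `|iter k T x|)%:E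
    | n in [set n | (0 < n)%N]] <= (C * `|x|)%:E)%E) ->
  forall (n : nat) (x : X),
    \sum_(0 <= k < n) `|iter k T x| <= C * n%:R * `|x|.
Proof.
move=> hC [|n] x; first by rewrite big_geq// mulr0 mul0r.
have := le_trans (ereal_sup_ubound (ex_intro2 _ _ n.+1 isT erefl)) (hC x).
by rewrite lee_fin ler_pdivrMl ?ltr0n// big_mkord mulrA (mulrC C).
Qed.

(** By linearity the Cesaro bound applies to every signed sum of [s]; averaging over the signs and
    using Khintchine on both sides costs 4 and [khintchine_const] to the power 1/p. *)
Lemma square_norm_Cesaro (C : R) (s : seq X) (n : nat) :
  (forall (n : nat) (x : X),
    \sum_(0 <= k < n) `|iter k T x| <= C * n%:R * `|x|) -> 0 <= C ->
  \sum_(0 <= k < n) square_norm (map (iter k T) s) <=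
  4 * C * (khintchine_const (p := p)) `^ p^-1 * n%:R * square_norm s.
Proof.
move=> hC C0.
apply: (@le_trans _ _ (\sum_(0 <= k < n)
    4 * sign_mean (fun x : X => `|iter k T x|) 0 s)).
  apply: ler_sum => k _; apply: le_trans (square_norm_le_sign_mean _) _.
  rewrite -{1}(iter_linear0 k).
  by rewrite (@sign_mean_map _ _ _ _ _ _ _ (iter_linearD k) (iter_linearB k)).
rewrite -mulr_sumr -sign_mean_sum -!mulrA ler_pM2l//.
apply: (@le_trans _ _ (sign_mean (fun x : X => C * n%:R * `|x|) 0 s)).
  by apply: le_sign_mean => x; exact: hC.
rewrite sign_meanZ -mulrA ler_wpM2l// [leRHS]mulrCA ler_wpM2l//.
exact: sign_mean_norm_le.
Qed.

End CesaroBounded.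

Theorem corollary2p6 (d : measure_display) (Omega : measurableType d)
    (R : realType) (mu : {sigma_finite_measure set Omega -> \bar R})
    (p : R) (p1 : 1 <= p)
    (T : {linear complex_Lspace mu p1 -> complex_Lspace mu p1}) :
  bounded_operator T -> absolutely_Cesaro_bounded T ->
  let p' := Num.min p 2 in
  let p'' := Num.max p 2 in
  (fun n : nat => operator_norm (iter n T)) =O_\oo
    (fun n : nat => n%:R `^ p'^-1 / ln n%:R `^ p''^-1) /\
  exists2 Cp : R, 0 < Cp &
    forall (x : complex_Lspace mu p1) (N : nat), (1 <= N)%N ->
      \sum_(k < N) `|iter k T x| `^ p'' <=
        Cp * N%:R `^ (p'' / p') * `|x| `^ p''.
Proof.
move=> _ [C C0 hC] p' p''; rewrite -/p' -/p''.
pose D : R := 4 * C * (khintchine_const (p := p)) `^ p^-1.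
have D0 : 0 < D.
  rewrite !mulr_gt0// powR_gt0// /khintchine_const !mulr_gt0 ?powR_gt0 ?expR_gt0//.
  by rewrite mulr_gt0// (lt_le_trans _ p1).
have t1 : 1 <= p' by rewrite le_min p1 ler1n.
have tr : p' <= p'' by rewrite ge_min le_max lexx.
(* For each fixed x this satisfies the hypotheses of the abstract counting section, with t = p', r =
   p'' and a constant [D] independent of x. *)
pose F (x : complex_Lspace mu p1) (I : seq nat) := square_norm [seq iter j T x | j <- I].
have F0 x I : 0 <= F x I by exact: square_norm_ge0.
have Fnil x : F x [::] = 0 by exact: square_norm_nil.
have Fperm x I J : perm_eq I J -> F x I = F x J.
  by move=> IJ; apply: square_norm_perm; exact: perm_map.
have Fsub x I J : F x (I ++ J) `^ p' <= F x I `^ p' + F x J `^ p'.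
  by rewrite /F map_cat; exact: square_norm_cat_sub.
have Fsup x I J : F x I `^ p'' + F x J `^ p'' <= F x (I ++ J) `^ p''.
  by rewrite /F map_cat; exact: square_norm_cat_sup.
have Fces x I M : \sum_(0 <= k < M) F x [seq (j + k)%N | j <- I] <= D * M%:R * F x I.
  have := @square_norm_Cesaro _ _ _ _ _ _ T C [seq iter j T x | j <- I] M
    (@absolutely_Cesaro_bounded_sum _ _ _ _ _ _ T C hC) (ltW C0).
  apply: le_trans; apply: ler_sum => k _; rewrite /F -!map_comp.
  rewrite (@eq_map _ _ _ (iter k T \o (fun j => iter j T x)))// => j /=.
  by rewrite addnC iterD.
have F1 x j : F x [:: j] = `|iter j T x| by exact: square_norm1.
split; last first.
  exists (8 * (64 * D ^+ 2) `^ p'').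
    by rewrite mulr_gt0// powR_gt0// mulr_gt0// exprn_gt0.
  move=> x N _.
  have := @cesaro_powR_sum R (F x) p'' p' D t1 tr D0 (F0 x) (Fnil x)
    (Fsub x) (Fsup x) (Fces x) N.
  rewrite F1 big_mkord; apply: le_trans; apply: ler_sum => k _.
  by rewrite F1.
pose B : R := 48 * D * (64 * D ^+ 2).
have DD0 : 0 < 64 * D ^+ 2 by rewrite mulr_gt0// exprn_gt0.
have B0 : 0 < B by rewrite mulr_gt0// mulr_gt0.
apply/eqO_exP; exists B => //; near=> n.
have n3 : (3 <= n)%N by near: n; exact: nbhs_infty_ge.
have n1 : 1 < n%:R :> R by rewrite ltr1n; lia.
have L0 : 0 < ln n%:R `^ p''^-1 :> R by rewrite powR_gt0// ln_gt0.
have bnd (x : complex_Lspace mu p1) : `|x| <= 1 ->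
    `|iter n T x| <= B * (n%:R `^ p'^-1 / ln n%:R `^ p''^-1).
  move=> x1.
  have := @F_growth R (F x) p'' p' D t1 tr D0 (F0 x) (Fnil x) (Fperm x)
    (Fsub x) (Fsup x) (Fces x) n n3.
  rewrite !F1 -ler_pdivlMr// => h; apply: le_trans h _.
  rewrite [leRHS]mulrA ler_pM2r ?invr_gt0//.
  have := ler_wpM2l (mulr_ge0 (ltW B0) (powR_ge0 n%:R p'^-1)) x1.
  by rewrite mulr1; apply: le_trans; rewrite /B !mulrA.
rewrite [X in _ <= _ * X]ger0_norm; last by rewrite divr_ge0 ?powR_ge0.
have ub : ubound [set `|iter n T x| | x in [set x : complex_Lspace mu p1 | `|x| <= 1]]
    (B * (n%:R `^ p'^-1 / ln n%:R `^ p''^-1)).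
  by move=> _ [x x1 <-]; exact: bnd.
(* Membership of 0 makes the supremum nonnegative, so that the absolute value around the operator
   norm can be removed. *)
have z0 : [set `|iter n T x| | x in [set x : complex_Lspace mu p1 | `|x| <= 1]] 0.
  by exists 0; rewrite /= ?normr0 ?iter_linear0 ?normr0.
rewrite ger0_norm; first by apply: ge_sup ub; exists 0.
by apply: ub_le_sup z0; exists (B * (n%:R `^ p'^-1 / ln n%:R `^ p''^-1)).
Unshelve. all: by end_near.
Qed.
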